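(* Let $k\ge 2$ and let $\{\Omega_j\}_{j\ge 1}$ be an increasing sequence ($\Omega_j\subset\Omega_{j+1}$ for all $j$) of Fatou-Bieberbach domains in $\mathbb{C}^k$ that are all Runge. Then $\Omega=\bigcup_{j=1}^\infty\Omega_j$ is biholomorphically equivalent to $\mathbb{C}^k$.
   Context: A Fatou-Bieberbach domain in $\mathbb{C}^k$ is a proper subdomain (open connected subset different from $\mathbb{C}^k$) of $\mathbb{C}^k$ that is biholomorphic to $\mathbb{C}^k$. It is Runge if every holomorphic function on it can be approximated, uniformly on compact subsets, by holomorphic polynomials (equivalently, entire functions) on $\mathbb{C}^k$. *)

(* Defs.v *)
From HB Require Import structures.
From mathcomp Require Import all_boot all_order all_algebra.
From mathcomp Require Import all_classical all_reals all_analysis.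
From mathcomp Require Import complex.
(* Not imported: the notations of mpoly clash with those of MathComp-Analysis. *)
From mathcomp Require mpoly.

Set Implicit Arguments.
Unset Strict Implicit.
Unset Printing Implicit Defensive.
Import Order.TTheory GRing.Theory Num.Theory.
Import numFieldNormedType.Exports.
Local Open Scope classical_set_scope.
Local Open Scope ring_scope.

(* The complex numbers over [R], packaged as a [numFieldType]: the normed-space
   structure of MathComp-Analysis is inferred from that structure, so that
   [differentiable] below means complex (Frechet) differentiability. *)
Definition Cplx (R : realType) : numFieldType := R[i].

Section SeveralComplexVariables.
Context {R : realType}.
Local Notation C := (Cplx R).

(* Meaningful for [U] open; the values of [f] outside [U] are irrelevant. *)
Definition holomorphic {V W : normedModType C} (U : set V) (f : V -> W) : Prop :=
  forall z, U z -> differentiable f z.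

Definition biholomorphic {V W : normedModType C} (U : set V) (U' : set W) : Prop :=
  exists (f : V -> W) (g : W -> V),
    [/\ holomorphic U f, holomorphic U' g,
        (forall z, U z -> U' (f z) /\ g (f z) = z) &
        (forall w, U' w -> U (g w) /\ f (g w) = w)].

Definition peval {k : nat} (p : mpoly.mpoly k C) (z : 'rV[C]_k) : C :=
  mpoly.meval (fun i => z ord0 i) p.

Definition fatou_bieberbach {k : nat} (U : set 'rV[C]_k) : Prop :=
  [/\ open U, connected U, U <> setT &
      biholomorphic U [set: 'rV[C]_k]].

(* [0 < e] in [C] says that [e] is a positive real number. *)
Definition runge {k : nat} (U : set 'rV[C]_k) : Prop :=
  forall f : 'rV[C]_k -> C, holomorphic U f ->
  forall K : set 'rV[C]_k, compact K -> K `<=` U ->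
  forall e : C, 0 < e ->
  exists p : mpoly.mpoly k C, forall z, K z -> `|f z - peval p z| < e.

End SeveralComplexVariables.

(* Main.v *)
Require Import Defs.
From HB Require Import structures.
From mathcomp Require Import all_boot all_order all_algebra.
From mathcomp Require Import all_classical all_reals all_analysis.
From mathcomp Require Import complex zify ring lra.
From mathcomp Require mpoly separable cyclic cyclotomic.
Import Order.TTheory GRing.Theory Num.Theory.
Import numFieldNormedType.Exports.
Local Open Scope classical_set_scope.
Local Open Scope ring_scope.
Set Implicit Arguments.
Unset Strict Implicit.
Unset Printing Implicit Defensive.

(** A biholomorphic map psi from a Runge domain onto C^k can be imitated, on a
    ball and on the preimage of the ball, by automorphisms of C^k: this is the
    theorem of Andersen and Lempert, [andersen_lempert]. The union of the
    domains is then built by a push-out. There are automorphisms s_n of C^k and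
    radii rho_n, tending to infinity, such that the sets
    A_n = { |s_n| <= rho_n } increase to the union, A_n lies in Omega_n, and
    |s_(n+1) - s_n| <= 2^-n / 64 on A_n ([automorphism_sequence]). To find
    s_(n+1), take psi from Omega_(n+1) onto C^k and an automorphism b which
    imitates its inverse; then s_n o b o psi maps Omega_(n+1) biholomorphically
    onto C^k and is close to s_n on a prescribed compact set, and s_(n+1) is an
    automorphism imitating this map ([adjust_automorphism]). Let theta be the
    limit of the s_n. The map theta o s_n^-1 is close to the identity on the
    ball of radius rho_n, so it is injective on a slightly smaller ball and
    covers a still smaller one ([near_id_inj], [near_id_inverse]); hence theta is
    a biholomorphic map from the union onto C^k.

    For the theorem of Andersen and Lempert, let G be the inverse of psi. The
    maps z |-> G (t z), for 0 < t <= 1, are carried to each other by the flow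
    of one vector field on the domain, the radial field transported by G, in
    the time log t. For small t they are nearly affine ([affine_start]). The
    field is holomorphic ([conjugated_radial_field]), so the Runge property
    approximates it by polynomial fields. As k >= 2, every polynomial field is a
    linear combination of fields whose flows are shears or overshears
    ([flowable_peval]); so a short step along it can be replaced by an
    automorphism. Seen through psi, such a step is a homothety of ratio 1 + h,
    up to an error small with respect to h ([radial_step]), and the relative
    errors of successive steps add up ([approximate_inverse]).

    The function theory is that of locally uniform limits of polynomials. By
    the Runge property every holomorphic function on the domains is one, and so
    are the components of the automorphisms and of their inverses. The Cauchy
    estimates are needed for polynomials only, where the mean over the roots of
    unity replaces the integral over the circle ([cauchy_coef]). They pass to
    limits and give differentiability, Taylor estimates and inverse maps. *)

(** * Real-valued norms *)

Section RealNorm.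
Context {R : realType}.
Local Notation C := (Cplx R).

(** The norm is a complex number and the order of [C] is partial; estimates are
    carried out with its real value. *)
Definition rn {V : normedModType C} (x : V) : R := complex.Re (`|x| : R[i]).
Definition cR (x : R) : C := (x%:C)%C.

Lemma cR_le (x y : R) : (cR x <= cR y) = (x <= y).
Proof. exact: lecR. Qed.
Lemma cR_lt (x y : R) : (cR x < cR y) = (x < y).
Proof. exact: ltcR. Qed.
Lemma cRD x y : cR (x + y) = cR x + cR y.
Proof. exact: (rmorphD (real_complex R)). Qed.
Lemma cRM x y : cR (x * y) = cR x * cR y.
Proof. exact: (rmorphM (real_complex R)). Qed.
Lemma cRI : injective cR.
Proof. exact: complexI. Qed.
Lemma cR0 : cR 0 = 0. Proof. by []. Qed.
Lemma cR1 : cR 1 = 1. Proof. by []. Qed.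

Section Normed.
Context {V : normedModType C}.
Implicit Types x y : V.

Lemma rnE x : `|x| = cR (rn x).
Proof.
have h : 0 <= (`|x| : C) by [].
rewrite /rn /cR; move: h; set t := (Num.norm x : C); case: t => a b /ger0_Im /= ->.
by [].
Qed.

Lemma rn_ge0 x : 0 <= rn x.
Proof. by rewrite -cR_le -rnE normr_ge0. Qed.
Lemma rn0 : rn (0 : V) = 0.
Proof. by apply: cRI; rewrite -rnE normr0. Qed.
Lemma rnN x : rn (- x) = rn x.
Proof. by apply: cRI; rewrite -!rnE normrN. Qed.
Lemma rn_sub x y : rn (x - y) = rn (y - x).
Proof. by rewrite -opprB rnN. Qed.
Lemma rnD x y : rn (x + y) <= rn x + rn y.
Proof. by rewrite -cR_le cRD -!rnE ler_normD. Qed.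
Lemma rn_eq0 x : rn x = 0 -> x = 0.
Proof. by move=> h; apply/eqP; rewrite -normr_eq0 rnE h cR0. Qed.
Lemma rn_tri z x y : rn (x - y) <= rn (x - z) + rn (z - y).
Proof. by rewrite -[x - y](subrKA z) rnD. Qed.
Lemma rnZ (c : C) x : rn (c *: x) = rn (c : C) * rn x.
Proof. by apply: cRI; rewrite cRM -!rnE normrZ. Qed.
End Normed.

Lemma rnM (c d : C) : rn (c * d : C) = rn (c : C) * rn (d : C).
Proof. by apply: cRI; rewrite cRM -!rnE normrM. Qed.
Lemma rn1 : rn (1 : C) = 1.
Proof. by apply: cRI; rewrite -rnE normr1. Qed.
Lemma rnX (c : C) n : rn (c ^+ n : C) = rn (c : C) ^+ n.
Proof. by elim: n => [|n ih]; rewrite ?expr0 ?rn1 // !exprS rnM ih. Qed.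
Lemma rn_cR (x : R) : rn (cR x) = `|x|.
Proof. by apply: cRI; rewrite -rnE /cR normc_def /= expr0n /= addr0 sqrtr_sqr. Qed.
Lemma rnV (c : C) : rn (c^-1 : C) = (rn (c : C))^-1.
Proof.
have [->|c0] := eqVneq c 0; first by rewrite invr0 rn0 invr0.
have h : rn (c : C) != 0 by apply/eqP => /rn_eq0 /eqP; rewrite (negPf c0).
by apply: (mulIf h); rewrite mulVf// -rnM mulVf// rn1.
Qed.

Lemma rn_sum (V : normedModType C) (I : Type) (r : seq I) (P : pred I) (F : I -> V) :
  rn (\sum_(i <- r | P i) F i) <= \sum_(i <- r | P i) rn (F i).
Proof.
elim/big_rec2: _ => [|i y1 y2 _ h]; first by rewrite rn0.
by apply: le_trans (rnD _ _) _; rewrite lerD2l.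
Qed.

Lemma rn_Re (c : C) : `|complex.Re (c : R[i])| <= rn c.
Proof. by rewrite -cR_le -rnE; exact: normc_ge_Re. Qed.

Lemma rn_Im (c : C) : `|complex.Im (c : R[i])| <= rn c.
Proof.
rewrite -cR_le -rnE normc_def cR_le -sqrtr_sqr ler_wsqrtr//.
by rewrite lerDr sqr_ge0.
Qed.

Lemma rn_ReIm (c : C) :
  rn c <= `|complex.Re (c : R[i])| + `|complex.Im (c : R[i])|.
Proof.
rewrite -cR_le -rnE normc_def cR_le.
set a := complex.Re _; set b := complex.Im _.
rewrite -(@ler_pXn2r _ 2) ?nnegrE ?sqrtr_ge0 ?addr_ge0//.
rewrite sqr_sqrtr ?addr_ge0 ?sqr_ge0// sqrrD !real_normK ?num_real//.
by rewrite -addrA [X in _ <= _ + X]addrC addrA lerDl mulrn_wge0// mulr_ge0.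
Qed.

Section Rows.
Context {k : nat}.
Implicit Types x y : 'rV[C]_k.

Lemma rn_coord x j : rn (x ord0 j) <= rn x.
Proof.
rewrite -cR_le -!rnE {2}/Num.norm/= mx_normE.
rewrite -[leLHS]nngE num_le.
apply/bigmax_geP; right; by exists (ord0, j).
Qed.

Lemma rn_rowP x (c : R) : 0 <= c -> (forall j, rn (x ord0 j) <= c) -> rn x <= c.
Proof.
move=> c0 h; have [->|x0] := eqVneq (rn x) 0; first exact: c0.
have /mx_norm_neq0[[i j] /=] : mx_norm x != 0.
  by apply: contra x0 => /eqP/mx_norm_eq0 ->; rewrite rn0.
rewrite ord1 -/(Num.norm x) => hx.
have -> : rn x = rn (x ord0 j) by apply: cRI; rewrite -!rnE -hx.
exact: h.
Qed.
End Rows.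
End RealNorm.

(** * Balls, compactness and differentials in normed spaces *)

Section Topology.
Context {R : realType}.
Local Notation C := (Cplx R).

Definition cball {V : normedModType C} (x : V) (r : R) : set V :=
  [set y | rn (y - x) <= r].

Lemma nbhs_cballP {V : normedModType C} (x : V) (A : set V) :
  nbhs x A <-> exists2 d : R, 0 < d & cball x d `<=` A.
Proof.
split=> [/nbhs_normP[e e0 h]|[d d0 h]].
  have er : e = cR (complex.Re (e : R[i])).
    by apply/esym; rewrite /cR; apply: RRe_real; rewrite realE (ltW e0).
  have e1 : 0 < complex.Re (e : R[i]) by rewrite -cR_lt -er.
  exists (complex.Re (e : R[i]) / 2); first by rewrite divr_gt0.
  move=> y; rewrite /cball /= => hy; apply: h => /=.
  rewrite rnE er cR_lt rn_sub; lra.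
apply/nbhs_normP; exists (cR d); first by rewrite /= -cR0 cR_lt.
by move=> y /=; rewrite rnE cR_lt rn_sub => /ltW; exact: h.
Qed.

Lemma open_cballP {V : normedModType C} (A : set V) :
  open A <-> forall x, A x -> exists2 d : R, 0 < d & cball x d `<=` A.
Proof.
rewrite openE; split=> h x Ax; first by apply/nbhs_cballP; exact: h.
by apply/nbhs_cballP; exact: h.
Qed.

Lemma continuous_cballP {V W : normedModType C} (f : V -> W) x :
  {for x, continuous f} <->
  forall e : R, 0 < e -> exists2 d : R, 0 < d &
    forall y, rn (y - x) <= d -> rn (f y - f x) <= e.
Proof.
split=> [h e e0|h A].
  have : nbhs (f x) (cball (f x) e) by apply/nbhs_cballP; exists e.
  by move=> /h /nbhs_cballP[d d0 hd]; exists d => // y /hd.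
move=> /nbhs_cballP[e e0 he]; apply/nbhs_cballP.
by have [d d0 hd] := h e e0; exists d => // y /hd /he.
Qed.

Lemma rn_continuous {V : normedModType C} : continuous (rn : V -> R).
Proof.
move=> x; apply/cvgrPdist_le => e e0.
suff : nbhs x (fun t => `|rn x - rn t| <= e) by [].
apply/nbhs_cballP; exists e => // y; rewrite /cball /= => h.
have := rn_tri y x 0; have := rn_tri x y 0; rewrite !subr0 (rn_sub x y) ler_norml.
by move=> h1 h2; apply/andP; split; lra.
Qed.

Lemma cball_closed {V : normedModType C} (x : V) r : closed (cball x r).
Proof.
have -> : cball x r = ((fun y => rn (y - x)) @^-1` [set t | t <= r]) by [].
apply: closed_comp; last exact: closed_le.
move=> y _; 
apply: (@continuous_comp _ _ _ (fun z : V => z - x) rn y); last first.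
  exact: rn_continuous.
by apply: continuousB; [exact: cvg_id|exact: cvg_cst].
Qed.

Lemma disc_compact (r : R) : compact [set z : C | rn z <= r].
Proof.
pose I : set R := [set` `[- r, r]].
pose m (p : R * R) : C := Complex p.1 p.2.
have mc : continuous m.
  move=> p; move=> A /nbhs_cballP[d d0 hA].
  have d2 : 0 < d / 2 by rewrite divr_gt0.
  exists (ball p.1 (d / 2), ball p.2 (d / 2)).
    by split; apply: nbhsx_ballx.
  move=> [a b] [/= ]; rewrite -!ball_normE /= => ha hb.
  apply: hA; rewrite /cball /=; apply: le_trans (rn_ReIm _) _ => /=.
  rewrite distrC in ha; rewrite distrC in hb; lra.
have cI : compact (m @` (I `*` I)).
  apply: continuous_compact; first exact: continuous_subspaceT.
  by apply: compact_setX; exact: segment_compact.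
apply: subclosed_compact cI _.
  by have := @cball_closed _ (0 : C) r; rewrite /cball; under eq_set do rewrite subr0.
move=> [a b] /= h; exists (a, b) => //=.
have := rn_Re (Complex a b : C); have := rn_Im (Complex a b : C) => /= h1 h2.
by split; rewrite /I /= in_itv /= -ler_norml; exact: le_trans h.
Qed.

Lemma cball_compact {k : nat} (x : 'rV[C]_k) r : compact (cball x r).
Proof.
have := @rV_compact C k (fun j => [set z : C | rn z <= rn x + r])
  (fun j => @disc_compact _).
move=> h; apply: subclosed_compact h _; first exact: cball_closed.
move=> y; rewrite /cball /= => h j; apply: le_trans (rn_coord y j) _.
by have := rn_tri x y 0; rewrite !subr0; lra.
Qed.

(** This is how compactness enters the estimates: the rank from which a property
    holds can be chosen uniformly once it can be chosen locally. *)
Lemma compact_uniform {V : normedModType C} (K : set V) (P : nat -> V -> Prop) :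
  compact K ->
  (forall x, K x -> exists d n, [/\ 0 < d &
     forall y m, rn (y - x) <= d -> (n <= m)%N -> P m y]) ->
  exists n, forall x, K x -> P n x.
Proof.
move=> /compact_near_coveringP /(_ _ (\oo : set_system nat) P _) cK h.
have [n _ hn] : \forall n \near \oo, K `<=` P n.
  apply: cK => x Kx; have [d [n [d0 hd]]] := h x Kx.
  exists (cball x d, [set m | (n <= m)%N]); first split => /=.
  - by apply/nbhs_cballP; exists d.
  - by exists n.
  - by move=> [y m] [/= hy hm]; exact: hd.
by exists n => x; apply: (hn n) => /=.
Qed.

Lemma compact_rn_bounded {V W : normedModType C} (K : set V) (f : V -> W) :
  compact K -> (forall x, K x -> {for x, continuous f}) ->
  exists n : nat, forall x, K x -> rn (f x) <= n%:R.
Proof.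
move=> cK fc; apply: (compact_uniform cK (P := fun n x => rn (f x) <= n%:R)) => x Kx.
have /continuous_cballP /(_ 1 ltr01)[d d0 hd] := fc x Kx.
exists d, (Num.truncn (rn (f x) + 1)).+1; split => // y m /hd h nm.
have := rn_tri (f x) (f y) 0; rewrite !subr0 => h1.
have h2 : rn (f x) + 1 < (Num.truncn (rn (f x) + 1)).+1%:R by rewrite truncnS_gt.
have h3 : (Num.truncn (rn (f x) + 1)).+1%:R <= m%:R :> R by rewrite ler_nat.
lra.
Qed.

Lemma invS_small (d : R) : 0 < d -> exists n : nat, forall m, (n <= m)%N -> m.+1%:R^-1 <= d.
Proof.
move=> d0; exists (Num.truncn d^-1) => m hm.
have h : d^-1 < (Num.truncn d^-1).+1%:R by rewrite truncnS_gt.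
rewrite -[leRHS]invrK lef_pV2 ?posrE ?invr_gt0 ?ltr0n//.
by apply: ltW; apply: lt_le_trans h _; rewrite ler_nat.
Qed.

Lemma compact_unif_continuous {V W : normedModType C} (K : set V) (f : V -> W) :
  compact K -> (forall x, K x -> {for x, continuous f}) -> forall e : R, 0 < e ->
  exists2 d : R, 0 < d &
    forall x y, K x -> rn (y - x) <= d -> rn (f y - f x) <= e.
Proof.
move=> cK fc e e0.
pose P n x := forall y, rn (y - x) <= n.+1%:R^-1 -> rn (f y - f x) <= e.
suff /(compact_uniform cK)[n hn] : forall x, K x -> exists d n, [/\ 0 < d &
    forall y m, rn (y - x) <= d -> (n <= m)%N -> P m y].
  by exists n.+1%:R^-1; rewrite ?invr_gt0 ?ltr0n// => x y Kx; exact: hn.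
move=> x Kx.
have e2 : 0 < e / 2 by rewrite divr_gt0.
have /continuous_cballP /(_ _ e2)[d d0 hd] := fc x Kx.
have d2 : 0 < d / 2 by rewrite divr_gt0.
have [n hn] := invS_small d2.
exists (d / 2), n; split => // y m hy nm z hz.
have hzy : rn (z - y) <= d / 2 := le_trans hz (hn m nm).
have h1 := rn_tri y z x; have h2 := rn_tri (f x) (f z) (f y).
rewrite (rn_sub (f x)) in h2.
have h3 : rn (f z - f x) <= e / 2 by apply: hd; lra.
have h4 : rn (f y - f x) <= e / 2 by apply: hd; lra.
lra.
Qed.

Lemma differentiable_cballP {V W : normedModType C} (f : V -> W) x :
  differentiable f x -> forall e : R, 0 < e -> exists2 d : R, 0 < d &
    forall h, rn h <= d -> rn (f (x + h) - f x - 'd f x h) <= e * rn h.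
Proof.
move=> /diff_locally /eqaddoP hf e e0.
have ce : 0 < cR e by rewrite -cR0 cR_lt.
have /nbhs_cballP[d d0 hd] := hf _ ce.
exists d => // h hh; have := hd h; rewrite /cball /= subr0 => /(_ hh).
rewrite !rnE -cRM cR_le; congr (rn _ <= _).
by rewrite -[LHS]/(f (h + x) - (f x + 'd f x h)) opprD addrA [h + x]addrC.
Qed.

Lemma is_diff_of_estimate {V W : normedModType C} (f : V -> W) x
    (L : {linear V -> W}) (c : R) :
  (forall h, rn (L h) <= c * rn h) ->
  (forall e : R, 0 < e -> exists2 d : R, 0 < d &
    forall h, rn h <= d -> rn (f (x + h) - f x - L h) <= e * rn h) ->
  is_diff x f L.
Proof.
move=> Lc hf.
have c0 : 0 < `|c| + 1 by rewrite ltr_wpDl.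
have Lcont : continuous L.
  move=> y; apply/continuous_cballP => e e0.
  exists (e / (`|c| + 1)); first by rewrite divr_gt0.
  move=> z hz; rewrite -linearB; apply: le_trans (Lc _) _.
  rewrite ler_pdivlMr// in hz; apply: le_trans hz.
  rewrite mulrC ler_wpM2l ?rn_ge0//; have := ler_norm c; lra.
have h : f \o shift x = cst (f x) + L +o_ 0 id.
  apply/eqaddoP => _/posnumP[e].
  have er : e%:num = cR (complex.Re (e%:num : R[i])).
    by apply/esym; rewrite /cR; apply: RRe_real; rewrite realE ltW.
  have e1 : 0 < complex.Re (e%:num : R[i]) by rewrite -cR_lt -er cR0.
  have [d d0 hd] := hf _ e1.
  apply/nbhs_cballP; exists d => // y; rewrite /cball /= subr0 => /hd.
  rewrite !rnE er -cRM cR_le; congr (rn _ <= _).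
  rewrite -[LHS]/(f (x + y) - f x - L y) -[RHS]/(f (y + x) - (f x + L y)).
  by rewrite opprD addrA [y + x]addrC.
have dL := diff_unique Lcont h.
apply: DiffDef => //; apply/diff_locallyP; rewrite dL; split => //.
Qed.

End Topology.

(** * Cauchy estimates for polynomial functions *)

Section Poly.
Context {R : realType}.
Local Notation C := (Cplx R).

Lemma primitive_root_exists N : (0 < N)%N -> exists z : C, N.-primitive_root z.
Proof.
move=> N0; pose p : {poly R[i]} := 'X^N - 1.
have [r Dp] := closed_field_poly_normal p.
move: Dp; rewrite (monicP _) ?monicXnsubC // scale1r => Dp.
have rn1 : all N.-unity_root r by apply/allP=> z; rewrite -root_prod_XsubC -Dp.
have sz_r : (N < (size r).+1)%N by rewrite -(size_prod_XsubC r id) -Dp size_XnsubC.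
have r_uniq : uniq r.
  rewrite -separable.separable_prod_XsubC -Dp cyclotomic.separable_Xn_sub_1//.
  by rewrite pnatr_eq0 -lt0n.
by have [z _ hz] := hasP (cyclic.has_prim_root N0 rn1 r_uniq sz_r); exists z.
Qed.

Lemma sum_root_powers N (x : C) : x ^+ N = 1 -> x != 1 -> \sum_(i < N) x ^+ i = 0.
Proof.
move=> xN x1; have := subrX1 x N; rewrite xN subrr => /esym/eqP.
by rewrite mulf_eq0 subr_eq0 (negPf x1) /= => /eqP.
Qed.

(** The mean of [q.[z ^+ i] * z ^+ (i * (N - n))] over the powers of a primitive
    root of unity [z] of order [N] is exactly the [n]-th coefficient as soon as [N]
    exceeds [n] and the degree. *)
Lemma cauchy_coef (q : {poly C}) (M : R) :
  (forall z : C, rn z <= 1 -> rn (q.[z] : C) <= M) -> forall n, rn (q`_n : C) <= M.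
Proof.
move=> hq n; pose N := (size q + n).+1.
have [z zN] := primitive_root_exists (ltn0Sn (size q + n)).
have zN1 : z ^+ N = 1 := prim_expr_order zN.
have N0 : (N%:R : C) != 0 by rewrite pnatr_eq0.
have rz : rn (z : C) = 1.
  have := rnX z N; rewrite zN1 rn1 => /esym/eqP.
  by rewrite pexpr_eq1 ?rn_ge0// => /eqP.
have key : \sum_(i < N) q.[z ^+ i] * z ^+ (i * (N - n)) = N%:R * q`_n.
  transitivity (\sum_(i < N) \sum_(m < N) q`_m * (z ^+ (m + (N - n))) ^+ i).
    apply: eq_bigr => i _; rewrite (@horner_coef_wide _ N); last first.
      by rewrite /N -addnS leq_addr.
    rewrite mulr_suml; apply: eq_bigr => m _.
    by rewrite -mulrA -!exprM -exprD; congr (_ * z ^+ _); lia.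
  have nN : (n < N)%N by rewrite /N; lia.
  rewrite exchange_big /= (bigD1 (Ordinal nN)) //=.
  rewrite [X in _ + X]big1 ?addr0; last first.
    move=> m mn; rewrite -mulr_sumr sum_root_powers ?mulr0//.
      by rewrite -exprM mulnC exprM zN1 expr1n.
    rewrite -(prim_order_dvd zN) addnBA; last exact: ltnW.
    apply/negP => /dvdnP[c hc]; move/eqP: mn; apply; apply/val_inj => /=.
    by have := ltn_ord m; case: c hc => [|[|c]] hc; nia.
  rewrite subnKC; last exact: ltnW.
  rewrite zN1 (eq_bigr (fun _ => q`_n)) => [|i _]; last by rewrite expr1n mulr1.
  by rewrite sumr_const card_ord mulr_natl.
have -> : q`_n = N%:R^-1 * \sum_(i < N) q.[z ^+ i] * z ^+ (i * (N - n)).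
  by rewrite key mulrA mulVf// mul1r.
rewrite rnM rnV mulrC ler_pdivrMr; last first.
  by rewrite lt_neqAle rn_ge0 andbT eq_sym; apply: contra N0 => /eqP/rn_eq0 ->.
have -> : rn (N%:R : C) = N%:R.
  have -> : (N%:R : C) = cR N%:R by rewrite /cR raddfMn.
  by rewrite rn_cR ger0_norm.
apply: le_trans (rn_sum _ _ _) _.
apply: le_trans (ler_sum _ (_ : forall i, true -> _ <= M)) _; last first.
  by rewrite sumr_const card_ord mulr_natr.
move=> i _; rewrite rnM !rnX rz expr1n mulr1; apply: hq.
by rewrite rnX rz expr1n.
Qed.

Lemma geom_le2 (r : R) n : 0 <= r <= 1 / 2 -> \sum_(i < n) r ^+ i <= 2.
Proof.
move=> /andP[r0 r1]; elim: n => [|n ih]; first by rewrite big_ord0.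
rewrite big_ord_recl expr0.
under eq_bigr do rewrite lift0 exprS.
rewrite -mulr_sumr; have : r * (\sum_(i < n) r ^+ i) <= 1 / 2 * 2.
  by apply: ler_pM => //; apply: sumr_ge0 => i _; exact: exprn_ge0.
lra.
Qed.

Lemma poly_tail (c : nat -> C) (M : R) (z : C) n : (forall i, rn (c i) <= M) ->
  rn z <= 1 / 2 -> rn (\sum_(i < n) c i * z ^+ i) <= 2 * M.
Proof.
move=> hc hz; have M0 : 0 <= M := le_trans (rn_ge0 _) (hc 0%N).
apply: le_trans (rn_sum _ _ _) _.
apply: (@le_trans _ _ (\sum_(i < n) M * rn z ^+ i)).
  by apply: ler_sum => i _; rewrite rnM rnX ler_wpM2r ?exprn_ge0 ?rn_ge0.
rewrite -mulr_sumr mulrC ler_wpM2r//; apply: geom_le2.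
by rewrite rn_ge0.
Qed.

(** All coefficients are bounded by [M], so the remainders are dominated by a
    geometric series of ratio at most one half. *)
Lemma poly_taylor2 (q : {poly C}) (M : R) (z : C) :
  (forall z : C, rn z <= 1 -> rn (q.[z] : C) <= M) -> rn z <= 1 / 2 ->
  rn (q.[z] - q`_0 - q`_1 * z : C) <= 2 * M * rn z ^+ 2 /\
  rn (q.[z] - q`_0 : C) <= 2 * M * rn z.
Proof.
move=> /cauchy_coef hq hz.
have -> : q.[z] = q`_0 + q`_1 * z + (\sum_(i < size q) q`_(i.+2) * z ^+ i) * z ^+ 2.
  rewrite (@horner_coef_wide _ (size q).+2); last by rewrite leqW.
  rewrite !big_ord_recl /= expr0 mulr1 expr1 addrA mulr_suml; congr (_ + _).
  by apply: eq_bigr => i _; rewrite /bump /= -mulrA -exprD addn2.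
set S := \sum_(i < _) _.
have hS : rn S <= 2 * M by apply: (poly_tail (c := fun i => q`_(i.+2))) => // i; exact: hq.
have r0 := rn_ge0 z; have S0 := rn_ge0 S.
split.
  rewrite (_ : _ - _ - _ = S * z ^+ 2); last by ring.
  by rewrite rnM rnX ler_wpM2r ?exprn_ge0.
rewrite (_ : _ - _ = (q`_1 + S * z) * z); last by ring.
rewrite rnM ler_wpM2r//.
have -> : q`_1 + S * z = \sum_(i < (size q).+1) q`_i.+1 * z ^+ i.
  rewrite big_ord_recl expr0 mulr1 mulr_suml; congr (_ + _).
  by apply: eq_bigr => i _; rewrite !lift0 exprSr mulrA.
by apply: (poly_tail (c := fun i => q`_(i.+1))) => // i; exact: hq.
Qed.

Section PolyFun.
Context {k : nat}.
Local Notation V := 'rV[C]_k.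

(** Generating polynomial functions by operations makes composition and
    restriction to complex lines inductive. *)
Inductive polyfun : (V -> C) -> Prop :=
| polyfun_cst c : polyfun (fun _ => c)
| polyfun_coord j : polyfun (fun u => u ord0 j)
| polyfun_add f g : polyfun f -> polyfun g -> polyfun (fun u => f u + g u)
| polyfun_mul f g : polyfun f -> polyfun g -> polyfun (fun u => f u * g u).

Lemma polyfun_opp f : polyfun f -> polyfun (fun u => - f u).
Proof.
move=> hf; rewrite (_ : (fun u => - f u) = (fun u => -1 * f u)).
  by apply: polyfun_mul => //; exact: polyfun_cst.
by apply/funext => u; rewrite mulN1r.
Qed.

Lemma polyfun_sub f g : polyfun f -> polyfun g -> polyfun (fun u => f u - g u).
Proof. by move=> hf hg; apply: polyfun_add => //; exact: polyfun_opp. Qed.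

Lemma polyfun_exp f n : polyfun f -> polyfun (fun u => f u ^+ n).
Proof.
move=> hf; elim: n => [|n ih]; first exact: polyfun_cst.
rewrite (_ : (fun u => _) = (fun u => f u * f u ^+ n)); first exact: polyfun_mul.
by apply/funext => u; rewrite exprS.
Qed.

Lemma polyfun_sum I (r : seq I) (P : pred I) (F : I -> V -> C) :
  (forall i, polyfun (F i)) -> polyfun (fun u => \sum_(i <- r | P i) F i u).
Proof.
move=> hF; elim: r => [|i r ih].
  rewrite (_ : (fun u => _) = (fun u => 0)); first exact: polyfun_cst.
  by apply/funext => u; rewrite big_nil.
rewrite (_ : (fun u => _) =
    (fun u => (if P i then F i u else 0) + \sum_(j <- r | P j) F j u)).
  by apply: polyfun_add => //; case: (P i) => //; exact: polyfun_cst.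
by apply/funext => u; rewrite big_cons; case: ifP; rewrite ?add0r.
Qed.

Lemma polyfun_prod I (r : seq I) (P : pred I) (F : I -> V -> C) :
  (forall i, polyfun (F i)) -> polyfun (fun u => \prod_(i <- r | P i) F i u).
Proof.
move=> hF; elim: r => [|i r ih].
  rewrite (_ : (fun u => _) = (fun u => 1)); first exact: polyfun_cst.
  by apply/funext => u; rewrite big_nil.
rewrite (_ : (fun u => _) =
    (fun u => (if P i then F i u else 1) * \prod_(j <- r | P j) F j u)).
  by apply: polyfun_mul => //; case: (P i) => //; exact: polyfun_cst.
by apply/funext => u; rewrite big_cons; case: ifP; rewrite ?mul1r.
Qed.

Lemma pevalE (p : mpoly.mpoly k C) (u : V) :
  peval p u = \sum_(m <- mpoly.msupp p) mpoly.mcoeff m p *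
    \prod_(i < k) u ord0 i ^+ (mpoly.fun_of_multinom m i).
Proof. exact: mpoly.mevalE. Qed.

Lemma peval_polyfun (p : mpoly.mpoly k C) : polyfun (peval p).
Proof.
rewrite (funext (pevalE p)).
apply: (@polyfun_sum _ _ xpredT (fun m (u : V) => mpoly.mcoeff m p *
  \prod_(i < k) u ord0 i ^+ (mpoly.fun_of_multinom m i))) => m.
apply: polyfun_mul; first exact: polyfun_cst.
by apply: polyfun_prod => i; apply: polyfun_exp; exact: polyfun_coord.
Qed.

Lemma polyfun_comp (f : V -> C) (g : V -> V) : polyfun f ->
  (forall j, polyfun (fun u => g u ord0 j)) -> polyfun (f \o g).
Proof.
move=> hf hg; elim: hf => [c|j|f1 f2 _ h1 _ h2|f1 f2 _ h1 _ h2] /=.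
- exact: polyfun_cst.
- exact: hg.
- exact: polyfun_add h1 h2.
- exact: polyfun_mul h1 h2.
Qed.

Lemma polyfun_bounded f r : polyfun f ->
  exists2 M : R, 0 <= M & forall u, rn u <= r -> rn (f u) <= M.
Proof.
elim=> [c|j|f1 f2 _ [M1 p1 h1] _ [M2 p2 h2]|f1 f2 _ [M1 p1 h1] _ [M2 p2 h2]].
- by exists (rn c) => //; exact: rn_ge0.
- exists `|r| => // u hu; apply: le_trans (rn_coord _ _) _.
  exact: le_trans hu (ler_norm _).
- exists (M1 + M2); first exact: addr_ge0.
  by move=> u hu; apply: le_trans (rnD _ _) _; apply: lerD; [exact: h1|exact: h2].
- exists (M1 * M2); first exact: mulr_ge0.
  by move=> u hu; rewrite rnM; apply: ler_pM; rewrite ?rn_ge0 ?h1 ?h2.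
Qed.

(** The differential at [w] of a function with gradient [D]. *)
Definition dotg (w : V) (D : 'I_k -> C) : C := \sum_j w ord0 j * D j.

(** The gradient comes with the restrictions to all complex lines, so that the
    one-variable estimates apply to every direction at once. *)
Lemma polyfun_line f : polyfun f -> exists2 D : 'I_k -> V -> C,
  (forall j, polyfun (D j)) & forall u w, exists2 q : {poly C},
    (forall z, f (u + z *: w) = q.[z]) & q`_1 = dotg w (D^~ u).
Proof.
elim=> [c|j|f1 f2 p1 [D1 h1 q1] p2 [D2 h2 q2]|f1 f2 p1 [D1 h1 q1] p2 [D2 h2 q2]].
- exists (fun _ _ => 0) => [j|u w]; first exact: polyfun_cst.
  exists c%:P; first by move=> z; rewrite hornerC.
  by rewrite coefC /dotg big1// => j _; rewrite mulr0.
- exists (fun i _ => (i == j)%:R) => [i|u w]; first exact: polyfun_cst.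
  exists ((u ord0 j)%:P + (w ord0 j) *: 'X).
    by move=> z; rewrite !mxE !hornerE mulrC.
  rewrite coefD coefC coefZ coefX /= add0r mulr1 /dotg (bigD1 j)//= eqxx mulr1.
  by rewrite big1 ?addr0// => i /negPf ->; rewrite mulr0.
- exists (fun j u => D1 j u + D2 j u) => [j|u w]; first exact: polyfun_add.
  have [a a1 a2] := q1 u w; have [b b1 b2] := q2 u w.
  exists (a + b); first by move=> z; rewrite hornerD a1 b1.
  rewrite coefD a2 b2 /dotg -big_split /=; apply: eq_bigr => j _.
  by rewrite mulrDr.
- exists (fun j u => D1 j u * f2 u + f1 u * D2 j u) => [j|u w].
    by apply: polyfun_add; exact: polyfun_mul.
  have [a a1 a2] := q1 u w; have [b b1 b2] := q2 u w.
  exists (a * b); first by move=> z; rewrite hornerM a1 b1.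
  have a0 : a`_0 = f1 u by rewrite -horner_coef0 -a1 scale0r addr0.
  have b0 : b`_0 = f2 u by rewrite -horner_coef0 -b1 scale0r addr0.
  rewrite coefM !big_ord_recl big_ord0 /= addr0 /bump /= addn0 subnn subn0.
  rewrite a0 b0 a2 b2 /dotg mulr_sumr mulr_suml -big_split /=.
  by apply: eq_bigr => j _; ring.
Qed.

(** Parametrize the complex line through [u] and [u + w] so that the unit disc
    is mapped into the ball of radius [r]. *)
Lemma polyfun_cauchy f D : polyfun f ->
  (forall u w, exists2 q : {poly C},
    (forall z, f (u + z *: w) = q.[z]) & q`_1 = dotg w (D^~ u)) ->
  forall u (r M : R), 0 < r -> (forall y, cball u r y -> rn (f y) <= M) ->
  forall w, rn (dotg w (D^~ u)) <= M * (rn w / r) /\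
   (rn w <= r / 2 -> rn (f (u + w) - f u - dotg w (D^~ u)) <= 2 * M * (rn w / r) ^+ 2
     /\ rn (f (u + w) - f u) <= 2 * M * (rn w / r)).
Proof.
move=> hf hD u r M r0 hM w.
have [w0|w0] := eqVneq (rn w) 0.
  have -> : w = 0 by exact: rn_eq0.
  have -> : dotg 0 (D^~ u) = 0 by rewrite /dotg big1// => j _; rewrite mxE mul0r.
  by rewrite !rn0 mul0r addr0 subrr subr0 expr0n /= !mulr0 !rn0.
have wp : 0 < rn w by rewrite lt_neqAle eq_sym w0 rn_ge0.
pose w' := cR (r / rn w) *: w; pose z0 := cR (rn w / r).
have z0w : z0 *: w' = w.
  rewrite scalerA -cRM (_ : rn w / r * (r / rn w) = 1) ?scale1r//.
  by field; rewrite w0 gt_eqF.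
have rz0 : rn z0 = rn w / r by rewrite rn_cR ger0_norm// divr_ge0// ltW.
have [q q1 q2] := hD u w'.
have hq (z : C) : rn z <= 1 -> rn (q.[z] : C) <= M.
  move=> hz; rewrite -q1; apply: hM; rewrite /cball /= [u + _]addrC addrK rnZ.
  rewrite rnZ rn_cR ger0_norm; last by rewrite divr_ge0// ltW.
  have -> : rn z * (r / rn w * rn w) = rn z * r by field; rewrite w0.
  by rewrite -[leRHS]mul1r ler_wpM2r// ltW.
have q0 : q`_0 = f u by rewrite -horner_coef0 -q1 scale0r addr0.
have dw : dotg w (D^~ u) = q`_1 * z0.
  rewrite q2 /dotg mulr_suml; apply: eq_bigr => j _.
  by rewrite -{1}z0w mxE; ring.
split.
  rewrite dw rnM rz0 ler_wpM2r//; last exact: cauchy_coef.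
  by rewrite divr_ge0// ltW.
move=> hw; have := @poly_taylor2 q M z0 hq.
rewrite q0 -q1 z0w -dw rz0; apply.
by rewrite ler_pdivrMr// mulrC mulrA mulr1.
Qed.

End PolyFun.
End Poly.

(** * Uniform limits of polynomial functions *)

Section Limits.
Context {R : realType}.
Local Notation C := (Cplx R).

Lemma half_pow_gt0 n : 0 < (1 / 2 : R) ^+ n.
Proof. by rewrite exprn_gt0// divr_gt0. Qed.

Lemma half_pow_le n : (1 / 2 : R) ^+ n <= n.+1%:R^-1.
Proof.
rewrite -[leRHS]mul1r ler_pdivlMr ?ltr0n//.
elim: n => [|n ih]; first by rewrite expr0 !mulr1.
have -> : (1 / 2 : R) ^+ n.+1 * n.+2%:R =
   1 / 2 * ((1/2) ^+ n * n.+1%:R) + 1 / 2 * (1/2) ^+ n.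
  by rewrite exprS -[n.+2]addn1 natrD; ring.
have : (1 / 2 : R) ^+ n <= 1 by rewrite exprn_ile1; lra.
lra.
Qed.

Lemma half_pow_small (c e : R) : 0 < e -> exists n, c * (1 / 2) ^+ n <= e.
Proof.
move=> e0; have c1 : 0 < `|c| + 1 by rewrite ltr_wpDl.
have [n hn] := @invS_small R (e / (`|c| + 1)) (divr_gt0 e0 c1).
exists n; have h := le_trans (half_pow_le n) (hn n (leqnn n)).
rewrite ler_pdivlMr// in h; apply: le_trans h.
rewrite mulrC ler_wpM2l ?(ltW (half_pow_gt0 n))//.
by apply: le_trans (ler_norm c) _; rewrite lerDl.
Qed.

Lemma le_of_half (a b c : R) : (forall n, a <= b + c * (1 / 2) ^+ n) -> a <= b.
Proof.
move=> h; rewrite leNgt; apply/negP => ab.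
have e0 : 0 < (a - b) / 2 by rewrite divr_gt0// subr_gt0.
have [n hn] := half_pow_small c e0; have := h n; lra.
Qed.

(** With [t n] the bound of the tail, [x n - t n] increases, [x n + t n] decreases,
    and the limit lies between them. *)
Lemma geometric_cvg_R (x : nat -> R) c : 
  (forall n, `|x n.+1 - x n| <= c * (1 / 2) ^+ n) ->
  exists l, forall n, `|l - x n| <= 2 * c * (1 / 2) ^+ n.
Proof.
move=> hx; pose t n : R := 2 * c * (1 / 2) ^+ n.
have c0 : 0 <= c by have := le_trans (normr_ge0 _) (hx 0%N); rewrite expr0 mulr1.
have tS n : t n.+1 = t n - c * (1 / 2) ^+ n by rewrite /t exprS; lra.
have step n : x n - t n <= x n.+1 - t n.+1 /\ x n.+1 + t n.+1 <= x n + t n.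
  by have := hx n; rewrite tS ler_norml => /andP[]; split; lra.
have t0 n : 0 <= t n by rewrite /t !mulr_ge0// ltW// half_pow_gt0.
have up m n : (m <= n)%N -> x m - t m <= x n - t n /\ x n + t n <= x m + t m.
  elim: n => [|n ih]; first by rewrite leqn0 => /eqP ->.
  rewrite leq_eqVlt => /predU1P[->//|]; rewrite ltnS => /ih[h1 h2].
  by have [h3 h4] := step n; split; [exact: le_trans h3|exact: le_trans h2].
have cross m n : x m - t m <= x n + t n.
  have [h1 _] := up m (maxn m n) (leq_maxl _ _).
  have [_ h2] := up n (maxn m n) (leq_maxr _ _).
  have := t0 (maxn m n); lra.
pose A : set R := [set x m - t m | m in setT].
have A0 : A !=set0 by exists (x 0%N - t 0%N), 0%N.
exists (sup A) => n; rewrite ler_norml; apply/andP; split.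
  have : x n - t n <= sup A.
    apply: sup_upper_bound; last by exists n.
    by split => //; exists (x 0%N + t 0%N) => _ [m _ <-].
  rewrite /t; lra.
have : sup A <= x n + t n by apply: ge_sup => // _ [m _ <-].
rewrite /t; lra.
Qed.

Lemma geometric_cvg_C (x : nat -> C) c :
  (forall n, rn (x n.+1 - x n : C) <= c * (1 / 2) ^+ n) ->
  exists l : C, forall n, rn (l - x n : C) <= 4 * c * (1 / 2) ^+ n.
Proof.
move=> hx.
have ReB (a b : C) : complex.Re (a - b : R[i]) = complex.Re (a : R[i]) - complex.Re (b : R[i]).
  by case: a => ??; case: b.
have ImB (a b : C) : complex.Im (a - b : R[i]) = complex.Im (a : R[i]) - complex.Im (b : R[i]).
  by case: a => ??; case: b.
have [a ha] := @geometric_cvg_R (fun n => complex.Re (x n : R[i])) c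
  (fun n => le_trans (eq_ind _ (fun t => `|t| <= _) (rn_Re _) _ (ReB _ _)) (hx n)).
have [b hb] := @geometric_cvg_R (fun n => complex.Im (x n : R[i])) c
  (fun n => le_trans (eq_ind _ (fun t => `|t| <= _) (rn_Im _) _ (ImB _ _)) (hx n)).
exists (Complex a b : R[i]) => n; apply: le_trans (rn_ReIm _) _.
rewrite ReB ImB /=; have := ha n; have := hb n; lra.
Qed.

Lemma geometric_cvg {k} (x : nat -> 'rV[C]_k) c :
  (forall n, rn (x n.+1 - x n) <= c * (1 / 2) ^+ n) ->
  exists l : 'rV[C]_k, forall n, rn (l - x n) <= 4 * c * (1 / 2) ^+ n.
Proof.
move=> hx.
have c0 : 0 <= c by have := le_trans (rn_ge0 _) (hx 0%N); rewrite expr0 mulr1.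
have /choice[l hl] : forall j, exists l : C, forall n,
    rn (l - x n ord0 j : C) <= 4 * c * (1 / 2) ^+ n.
  move=> j; apply: geometric_cvg_C => n; apply: le_trans (hx n).
  by have := rn_coord (x n.+1 - x n) j; rewrite !mxE.
exists (\row_j l j) => n; apply: rn_rowP => [|j].
  by rewrite !mulr_ge0// ltW// half_pow_gt0.
by rewrite !mxE.
Qed.
End Limits.

Section Approximable.
Context {R : realType} {k : nat}.
Local Notation C := (Cplx R).
Local Notation V := 'rV[C]_k.

(** A function with this property near a point is holomorphic there, and the
    Runge property provides it on compact sets: it stands for holomorphy in what
    follows. *)
Definition apx (U : set V) (f : V -> C) : Prop := forall e : R, 0 < e ->
  exists2 p : V -> C, polyfun p & forall u, U u -> rn (f u - p u) <= e.

Definition apxV (U : set V) (g : V -> V) : Prop :=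
  forall j, apx U (fun u => g u ord0 j).

Lemma polyfun_apx U (p : V -> C) : polyfun p -> apx U p.
Proof. by move=> hp e e0; exists p => // u _; rewrite subrr rn0 ltW. Qed.

Lemma apxS U U' f : U `<=` U' -> apx U' f -> apx U f.
Proof. by move=> UU' h e /h[p pp hp]; exists p => // u /UU'; exact: hp. Qed.

Lemma apxVS U U' g : U `<=` U' -> apxV U' g -> apxV U g.
Proof. by move=> h hg j; exact: apxS (hg j). Qed.

Lemma apx_ext U f g : (forall u, U u -> f u = g u) -> apx U f -> apx U g.
Proof. by move=> fg h e /h[p pp hp]; exists p => // u Uu; rewrite -fg//; exact: hp. Qed.

Lemma apx_add U f g : apx U f -> apx U g -> apx U (fun u => f u + g u).
Proof.
move=> hf hg e e0; have e2 : 0 < e / 2 by rewrite divr_gt0.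
have [p pp hp] := hf _ e2; have [q pq hq] := hg _ e2.
exists (fun u => p u + q u); first exact: polyfun_add.
move=> u Uu; rewrite opprD addrACA; apply: le_trans (rnD _ _) _.
have := hp u Uu; have := hq u Uu; lra.
Qed.

Lemma apx_opp U f : apx U f -> apx U (fun u => - f u).
Proof.
move=> hf e /hf[p pp hp]; exists (fun u => - p u); first exact: polyfun_opp.
by move=> u /hp; rewrite -opprD rnN.
Qed.

Lemma apx_lim U f : (forall e : R, 0 < e -> exists2 g, apx U g &
  forall u, U u -> rn (f u - g u) <= e) -> apx U f.
Proof.
move=> h e e0; have e2 : 0 < e / 2 by rewrite divr_gt0.
have [g hg fg] := h _ e2; have [p pp hp] := hg _ e2.
exists p => // u Uu; apply: le_trans (rn_tri (g u) _ _) _.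
have := fg u Uu; have := hp u Uu; lra.
Qed.

Lemma apxV_lim U (f : V -> V) : (forall e : R, 0 < e -> exists2 g, apxV U g &
  forall u, U u -> rn (f u - g u) <= e) -> apxV U f.
Proof.
move=> h j; apply: apx_lim => e /h[g hg fg]; exists (fun u => g u ord0 j) => // u /fg.
by apply: le_trans; have := rn_coord (f u - g u) j; rewrite !mxE.
Qed.

Lemma polyfun_unif (p : V -> C) (M e : R) : polyfun p -> 0 < e ->
  exists2 d : R, 0 < d & forall u v, rn u <= M -> rn (v - u) <= d -> rn (p v - p u) <= e.
Proof.
move=> pp e0; have [D _ hD] := polyfun_line pp.
have [B B0 hB] := polyfun_bounded (M + 1) pp.
exists (Num.min (1 / 2) (e / (2 * (B + 1)))).
  by rewrite lt_min !divr_gt0//= mulr_gt0// ltr_wpDl.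
move=> u v hu; rewrite le_min => /andP[h1 h2].
have [|_ /(_ _)[|_]] := @polyfun_cauchy _ _ p D pp hD u 1 B ltr01 _ (v - u).
- move=> y hy; apply: hB; rewrite /cball /= in hy.
  by have := rn_tri u y 0; rewrite !subr0; lra.
- by [].
rewrite [u + _]addrC subrK divr1 => h; apply: le_trans h _.
rewrite ler_pdivlMr in h2; last by rewrite mulr_gt0// ltr_wpDl.
apply: le_trans h2; have := rn_ge0 (v - u); nra.
Qed.

(** The bound [M] confines the inner approximations to a ball on which the outer
    polynomial is uniformly continuous. *)
Lemma apx_comp U W f (g : V -> V) (M : R) : apx W f -> apxV U g ->
  (forall u, U u -> W (g u) /\ rn (g u) <= M) -> apx U (f \o g).
Proof.
move=> hf hg UW e e0; have e2 : 0 < e / 2 by rewrite divr_gt0.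
have [p pp hp] := hf _ e2.
have [d d0 hd] := polyfun_unif M pp e2.
have /choice[q hq] : forall j, exists q : V -> C, polyfun q /\
   forall u, U u -> rn (g u ord0 j - q u) <= d.
  by move=> j; have [q ? ?] := hg j _ d0; exists q.
exists (p \o (fun u => \row_j q j u)).
  apply: polyfun_comp => // j.
  rewrite (_ : (fun u => _) = q j); first by have [] := hq j.
  by apply/funext => u; rewrite mxE.
move=> u Uu /=; have [Wg gM] := UW u Uu.
apply: le_trans (rn_tri (p (g u)) _ _) _.
have h1 := hp _ Wg; suff h2 : rn (p (g u) - p (\row_j q j u)) <= e / 2 by lra.
rewrite rn_sub; apply: hd => //; apply: rn_rowP => [|j]; first exact: ltW.
by rewrite !mxE rn_sub; apply: (hq j).2.
Qed.

Lemma apxV_comp U W (f g : V -> V) (M : R) : apxV W f -> apxV U g ->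
  (forall u, U u -> W (g u) /\ rn (g u) <= M) -> apxV U (f \o g).
Proof. by move=> hf hg h j; exact: (apx_comp (hf j) hg h). Qed.

Lemma dotg_delta (D : 'I_k -> C) j : dotg (delta_mx 0 j) D = D j.
Proof.
rewrite /dotg (bigD1 j)//= !mxE !eqxx mul1r big1 ?addr0// => i /negPf ij.
by rewrite mxE ij andbF mul0r.
Qed.

Lemma rn_delta (j : 'I_k) : rn (delta_mx 0 j : V) <= 1.
Proof.
apply: rn_rowP => // i; rewrite mxE; case: (_ && _); first by rewrite rn1.
by rewrite rn0.
Qed.

Lemma dotg_bound (w : V) (D : 'I_k -> C) (c : R) : (forall j, rn (D j) <= c) ->
  rn (dotg w D) <= k%:R * c * rn w.
Proof.
move=> h; apply: le_trans (rn_sum _ _ _) _.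
apply: (@le_trans _ _ (\sum_(j < k) c * rn w)).
  apply: ler_sum => j _; rewrite rnM mulrC.
  by apply: ler_pM; rewrite ?rn_ge0// rn_coord.
by rewrite sumr_const card_ord -mulrA mulr_natl.
Qed.

(** By the Cauchy estimates for their differences, the gradients of the
    approximating polynomials converge geometrically, and the inequalities of
    [polyfun_cauchy] pass to the limit. *)
Lemma apx_gradient f (u0 : V) (r : R) : 0 < r -> apx (cball u0 (2 * r)) f ->
  exists2 D : 'I_k -> V -> C, (forall j, apx (cball u0 r) (D j)) &
   forall M : R, (forall y, cball u0 (2 * r) y -> rn (f y) <= M) ->
   forall u, cball u0 r u -> forall w, 
     rn (dotg w (D^~ u)) <= M * (rn w / r) /\
     (rn w <= r / 2 -> rn (f (u + w) - f u - dotg w (D^~ u)) <= 2 * M * (rn w / r) ^+ 2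
       /\ rn (f (u + w) - f u) <= 2 * M * (rn w / r)).
Proof.
move=> r0 hf.
have /choice[p /all_and2[pp hp]] : forall n, exists p : V -> C, polyfun p /\
    forall u, cball u0 (2 * r) u -> rn (f u - p u) <= (1 / 2) ^+ n.
  by move=> n; have [p ? ?] := hf _ (half_pow_gt0 n); exists p.
have /choice[D /all_and2[Dp hD]] : forall n, exists D : 'I_k -> V -> C,
    (forall j, polyfun (D j)) /\ forall u w, exists2 q : {poly C},
    (forall z, p n (u + z *: w) = q.[z]) & q`_1 = dotg w (D^~ u).
  by move=> n; have [D' ? ?] := polyfun_line (pp n); exists D'.
have sub_ball u y : cball u0 r u -> cball u r y -> cball u0 (2 * r) y.
  by rewrite /cball /= => h1 h2; have := rn_tri u y u0; lra.
have diffD n u j : cball u0 r u ->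
    rn (D n.+1 j u - D n j u) <= (2 / r) * (1 / 2) ^+ n.
  move=> hu.
  have hl : forall u w, exists2 q : {poly C},
    (forall z, p n.+1 (u + z *: w) - p n (u + z *: w) = q.[z]) &
    q`_1 = dotg w (fun i => D n.+1 i u - D n i u).
    move=> v w; have [a a1 a2] := hD n.+1 v w; have [b b1 b2] := hD n v w.
    exists (a - b); first by move=> z; rewrite hornerD hornerN a1 b1.
    rewrite coefB a2 b2 /dotg -sumrB; apply: eq_bigr => i _.
    by rewrite mulrBr.
  have [|h _] := @polyfun_cauchy _ _ _ _ (polyfun_sub (pp n.+1) (pp n)) hl u r
     (2 * (1 / 2) ^+ n) r0 _ (delta_mx 0 j).
    move=> y /(sub_ball u y hu) hy; apply: le_trans (rn_tri (f y) _ _) _.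
    have h1 := hp n y hy; have := hp n.+1 y hy; rewrite exprS rn_sub.
    have := half_pow_gt0 (R := R) n; lra.
  rewrite dotg_delta in h; apply: le_trans h _.
  rewrite [2 / r * _]mulrAC -[X in _ <= X]mulrA.
  have := half_pow_gt0 (R := R) n; have := rn_delta j => h1 h2.
  rewrite -!mulrA ler_wpM2l// ler_wpM2l ?(ltW h2)//.
  by rewrite -[leRHS]mul1r ler_wpM2r// invr_ge0 ltW.
have /choice[L hL] : forall ju : 'I_k * V, exists l : C, cball u0 r ju.2 ->
    forall n, rn (l - D n ju.1 ju.2) <= 4 * (2 / r) * (1 / 2) ^+ n.
  move=> [j u] /=; have [hu|hu] := pselect (cball u0 r u); last by exists 0.
  by have [l hl] := geometric_cvg_C (fun n => diffD n u j hu); exists l.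
exists (fun j u => L (j, u)).
  move=> j e e0; have [n hn] := half_pow_small (4 * (2 / r)) e0.
  exists (D n j) => // u hu; exact: le_trans (hL (j, u) hu n) hn.
move=> M hM u hu w.
have dD n : rn (dotg w (fun j => L (j, u)) - dotg w (D n ^~ u)) <=
    k%:R * (4 * (2 / r) * (1 / 2) ^+ n) * rn w.
  rewrite /dotg -sumrB; under eq_bigr do rewrite -mulrBr.
  by apply: dotg_bound => j; exact: (hL (j, u)).
have pM n y : cball u r y -> rn (p n y) <= M + (1 / 2) ^+ n.
  move=> /(sub_ball u y hu) hy; have := rn_tri (f y) (p n y) 0; rewrite !subr0.
  have := hM y hy; have := hp n y hy; rewrite rn_sub; lra.
have cau n := @polyfun_cauchy _ _ _ _ (pp n) (hD n) u r _ r0 (pM n) w.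
have uu : cball u0 (2 * r) u.
  by apply: (sub_ball u u hu); rewrite /cball /= subrr rn0 ltW.
pose b := rn w / r; have b0 : 0 <= b by rewrite divr_ge0 ?rn_ge0 ?ltW.
pose K := k%:R * (4 * (2 / r)) * rn w.
split.
  apply: (@le_of_half _ _ _ (b + K)) => n.
  have [h _] := cau n; have h2 := dD n.
  have := rn_tri (dotg w (D n ^~ u)) (dotg w (fun j => L (j, u))) 0; rewrite !subr0.
  rewrite -/b in h *; rewrite /K; nra.
move=> hw.
have uw : cball u0 (2 * r) (u + w).
  by apply: (sub_ball u _ hu); rewrite /cball /= [u + w]addrC addrK; lra.
split.
  apply: (@le_of_half _ _ _ (2 * b ^+ 2 + K + 2)) => n.
  have [_ /(_ hw)[h _]] := cau n; have h2 := dD n.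
  have -> : f (u + w) - f u - dotg w (fun j => L (j, u)) =
     (p n (u + w) - p n u - dotg w (D n ^~ u)) + ((f (u + w) - p n (u + w)) -
       (f u - p n u)) - (dotg w (fun j => L (j, u)) - dotg w (D n ^~ u)) by ring.
  apply: le_trans (rnD _ _) _; rewrite rnN.
  have := rnD (p n (u + w) - p n u - dotg w (D n ^~ u)) ((f (u + w) - p n (u + w)) -
       (f u - p n u)).
  have := rnD (f (u + w) - p n (u + w)) (- (f u - p n u)); rewrite rnN.
  have := hp n _ uw; have := hp n _ uu; rewrite -/b in h *; rewrite /K.
  have := half_pow_gt0 (R := R) n; nra.
apply: (@le_of_half _ _ _ (2 * b + 2)) => n.
have [_ /(_ hw)[_ h]] := cau n.
have -> : f (u + w) - f u = (p n (u + w) - p n u) + ((f (u + w) - p n (u + w)) -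
       (f u - p n u)) by ring.
apply: le_trans (rnD _ _) _.
have := rnD (f (u + w) - p n (u + w)) (- (f u - p n u)); rewrite rnN.
have := hp n _ uw; have := hp n _ uu; rewrite -/b in h *.
have := half_pow_gt0 (R := R) n; nra.
Qed.

End Approximable.

(** * Differentials of limits, and maps close to the identity *)

Section Differentiation.
Context {R : realType} {k : nat}.
Local Notation C := (Cplx R).
Local Notation V := 'rV[C]_k.

(** A name for [dotg ^~ D], to carry the structure of a linear map. *)
Definition dotgl (D : 'I_k -> C) (w : V) : C := dotg w D.

Fact dotgl_is_linear D : linear (dotgl D).
Proof.
move=> a x y; rewrite /dotgl /dotg scaler_sumr -big_split; apply: eq_bigr => j _ /=.
by rewrite !mxE mulrDl -scalerAl.
Qed.

HB.instance Definition _ D := GRing.isLinear.Build C V C _ (dotgl D) (dotgl_is_linear D).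

Lemma is_diff_quadratic (f : V -> C) u (D : 'I_k -> C) (B d : R) : 0 < d ->
  (forall w, rn w <= d -> rn (f (u + w) - f u - dotg w D) <= B * rn w ^+ 2) ->
  is_diff u f (dotgl D).
Proof.
move=> d0 h.
pose c : R := \big[Num.max/0]_j rn (D j).
apply: (@is_diff_of_estimate _ _ _ _ _ _ (k%:R * c)).
  by move=> w; apply: dotg_bound => j; rewrite /c; apply: le_bigmax.
move=> e e0; have b1 : 0 < `|B| + 1 by rewrite ltr_wpDl.
exists (Num.min d (e / (`|B| + 1))); first by rewrite lt_min d0 divr_gt0.
move=> w; rewrite le_min => /andP[/h h1 h2]; apply: le_trans h1 _.
rewrite ler_pdivlMr// in h2; have := ler_norm B; have := rn_ge0 w; nra.
Qed.

Lemma apx_bounded (U : set V) f (M : R) : (forall u, U u -> rn u <= M) -> apx U f ->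
  exists2 B : R, 0 <= B & forall u, U u -> rn (f u) <= B.
Proof.
move=> hU /(_ 1 ltr01)[p pp hp]; have [B B0 hB] := polyfun_bounded M pp.
exists (B + 1); first by rewrite addr_ge0.
move=> u Uu; have := rn_tri (p u) (f u) 0; rewrite !subr0.
have := hp u Uu; have := hB u (hU u Uu); lra.
Qed.

Lemma apxV_bounded (U : set V) g (M : R) : (forall u, U u -> rn u <= M) -> apxV U g ->
  exists2 B : R, 0 <= B & forall u, U u -> rn (g u) <= B.
Proof.
move=> hU hg.
have /choice[B /all_and2[B0 hB]] : forall j, exists B : R, 0 <= B /\
    forall u, U u -> rn (g u ord0 j) <= B.
  by move=> j; have [B ? ?] := apx_bounded hU (hg j); exists B.
exists (\sum_j B j); first exact: sumr_ge0.
move=> u Uu; apply: rn_rowP => [|j]; first exact: sumr_ge0.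
apply: le_trans (hB j u Uu) _; rewrite (bigD1 j)//= lerDl.
exact: sumr_ge0.
Qed.

Lemma cball_rn (u0 : V) r u : cball u0 r u -> rn u <= rn u0 + r.
Proof. by rewrite /cball /= => h; have := rn_tri u0 u 0; rewrite !subr0; lra. Qed.

(** The quadratic remainder in [apx_gradient] identifies the limit of the gradients
    with the differential; so partial derivatives are again limits of polynomials,
    on a ball of half the radius. *)
Lemma apx_diff f (u0 : V) (r : R) : 0 < r -> apx (cball u0 (2 * r)) f ->
  [/\ forall u, cball u0 r u -> differentiable f u,
   forall j, apx (cball u0 r) (fun u => 'd f u (delta_mx 0 j)) &
   forall M : R, (forall y, cball u0 (2 * r) y -> rn (f y) <= M) ->
   forall u, cball u0 r u -> forall w, 
     rn ('d f u w : C) <= M * (rn w / r) /\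
     (rn w <= r / 2 -> rn (f (u + w) - f u - 'd f u w) <= 2 * M * (rn w / r) ^+ 2
       /\ rn (f (u + w) - f u) <= 2 * M * (rn w / r))].
Proof.
move=> r0 hf; have [D hD h] := apx_gradient r0 hf.
have [B B0 hB] := apx_bounded (@cball_rn u0 (2 * r)) hf.
have isd u : cball u0 r u -> is_diff u f (dotgl (D^~ u)).
  move=> hu; apply: (@is_diff_quadratic _ _ _ (2 * B / r ^+ 2) (r / 2)).
    by rewrite divr_gt0.
  move=> w hw; have [_ /(_ hw)[h1 _]] := h B hB u hu w; apply: le_trans h1 _.
  by rewrite exprMn exprVn mulrCA mulrC -!mulrA.
have dE u w : cball u0 r u -> 'd f u w = dotg w (D^~ u).
  by move=> /isd [_ ->].
split=> [u /isd[]//|j|M hM u hu w].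
  by apply: apx_ext (hD j) => u hu; rewrite dE// dotg_delta.
by rewrite dE//; exact: h.
Qed.

Lemma apx_differentiable f (u0 : V) (r : R) : 0 < r -> apx (cball u0 r) f ->
  differentiable f u0.
Proof.
move=> r0 hf; have r2 : 0 < r / 2 by rewrite divr_gt0.
have [|h _ _] := @apx_diff f u0 (r / 2) r2.
  by rewrite mulrC divfK.
by apply: h; rewrite /cball /= subrr rn0 ltW.
Qed.

Lemma differentiable_row (g : V -> V) u :
  (forall j, differentiable (fun v => g v ord0 j : C) u) -> differentiable g u.
Proof.
move=> h; rewrite (_ : g = \sum_(j < k) (fun v => g v ord0 j *: (delta_mx 0 j : V))).
  by apply: differentiable_sum => j; exact: differentiableZl.
by apply/funext => v; rewrite fct_sumE [LHS]row_sum_delta.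
Qed.

Lemma apxV_differentiable g (u0 : V) (r : R) : 0 < r -> apxV (cball u0 r) g ->
  differentiable g u0.
Proof. by move=> r0 h; apply: differentiable_row => j; apply: apx_differentiable r0 _. Qed.

Lemma diff_coordE (g : V -> V) u w j : differentiable g u ->
  ('d g u w) ord0 j = 'd (fun v => g v ord0 j : C) u w.
Proof.
move=> hg.
have := @diff_comp _ _ _ _ g (fun v : V => v ord0 j : C) u hg (differentiable_coord _ _ _).
move=> /(congr1 (fun f => f w)) /= ->.
have [_ /(congr1 (fun f => f ('d g u w)))] : is_diff (g u) (fun v : V => v ord0 j : C)
    (dotgl (fun i => (i == j)%:R)).
  apply: (@is_diff_quadratic _ _ _ 0 1) => // v _.
  have -> : dotg v (fun i : 'I_k => (i == j)%:R : C) = v ord0 j.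
    rewrite /dotg (bigD1 j)//= eqxx mulr1 big1 ?addr0// => i /negPf ->.
    by rewrite mulr0.
  by rewrite !mxE [_ + v _ _]addrC addrK subrr rn0 mul0r.
move=> ->; rewrite /dotgl /dotg (bigD1 j)//= eqxx mulr1 big1 ?addr0// => i /negPf ->.
by rewrite mulr0.
Qed.

End Differentiation.

Section Automorphisms.
Context {R : realType} {k : nat}.
Local Notation C := (Cplx R).
Local Notation V := 'rV[C]_k.

Definition entV (s : V -> V) : Prop := forall r : R, apxV (cball 0 r) s.

(** The inverse is part of the data: both directions have to be limits of polynomials. *)
Definition aut (s t : V -> V) : Prop := [/\ entV s, entV t, cancel s t & cancel t s].

Lemma cball0E (r : R) (u : V) : cball 0 r u = (rn u <= r).
Proof. by rewrite /cball /= subr0. Qed.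

Lemma entV_bounded s (r : R) : entV s ->
  exists2 B : R, 0 <= B & forall u, rn u <= r -> rn (s u) <= B.
Proof.
move=> hs; have [u|B B0 hB] := @apxV_bounded _ _ (cball 0 r) s r _ (hs r).
  by rewrite cball0E.
by exists B => // u hu; apply: hB; rewrite cball0E.
Qed.

Lemma entV_apx U g s (M : R) : (forall u, U u -> rn (g u) <= M) -> apxV U g ->
  entV s -> apxV U (s \o g).
Proof.
move=> hU hg hs; apply: (apxV_comp (W := cball 0 M) (M := M)) => // u /hU.
by rewrite cball0E.
Qed.

Lemma entV_comp s s' : entV s -> entV s' -> entV (s' \o s).
Proof.
move=> hs hs' r; have [B B0 hB] := entV_bounded r hs.
by apply: (@entV_apx _ _ _ B) => // u; rewrite cball0E; exact: hB.
Qed.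

Lemma entV_polyfun (s : V -> V) : (forall j, polyfun (fun u => s u ord0 j)) -> entV s.
Proof. by move=> h r j; exact: polyfun_apx. Qed.

Lemma entV_id : entV id.
Proof. by apply: entV_polyfun => j; exact: polyfun_coord. Qed.

Lemma entV_differentiable s u : entV s -> differentiable s u.
Proof.
move=> hs; apply: (@apxV_differentiable _ _ _ _ 1) => //.
apply: apxVS (hs (rn u + 1)) => v /cball_rn; rewrite cball0E.
exact.
Qed.

Lemma entV_continuous s : entV s -> continuous s.
Proof. by move=> hs u; apply: differentiable_continuous; exact: entV_differentiable. Qed.

Lemma aut_sym s t : aut s t -> aut t s.
Proof. by case. Qed.

Lemma aut_comp s t s' t' : aut s t -> aut s' t' -> aut (s' \o s) (t \o t').
Proof.
move=> [hs ht st ts] [hs' ht' st' ts']; split; try exact: entV_comp.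
- by move=> u /=; rewrite st' st.
- by move=> u /=; rewrite ts ts'.
Qed.

Lemma aut_id : aut id id.
Proof. by split => //; exact: entV_id. Qed.

(** One unit inside the ball, the Cauchy estimate turns the bound on [q - id] into
    a bound on its variation between points at distance less than 1/4; for the
    other pairs of points the bound on [q - id] itself suffices. *)
Lemma near_id_lipschitz (q : V -> V) (r e : R) : e <= 1 / 16 ->
  apxV (cball 0 r) q -> (forall z, rn z <= r -> rn (q z - z) <= e) ->
  forall z z', rn z <= r - 1 -> rn z' <= r - 1 ->
    rn ((q z' - z') - (q z - z)) <= 1 / 2 * rn (z' - z).
Proof.
move=> e16 hq qe z z' hz hz'.
have r0 : 0 < 1 / 2 :> R by lra.
have [far|near] := lerP (1 / 4) (rn (z' - z)).
  apply: le_trans (rnD _ _) _; rewrite rnN.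
  have h1 : rn (q z - z) <= e by apply: qe; lra.
  have h2 : rn (q z' - z') <= e by apply: qe; lra.
  lra.
apply: rn_rowP => [|j]; first by rewrite mulr_ge0 ?rn_ge0// ltW.
pose f u := q u ord0 j - u ord0 j.
have inc u : cball z (2 * (1 / 2)) u -> rn u <= r.
  by move=> /cball_rn; lra.
have hf : apx (cball z (2 * (1 / 2))) f.
  apply: apx_add; last by apply/polyfun_apx/polyfun_opp/polyfun_coord.
  by apply: apxS (hq j) => u /inc; rewrite cball0E.
have [_ _ hL] := apx_diff r0 hf.
have fe y : cball z (2 * (1 / 2)) y -> rn (f y) <= e.
  move=> /inc /qe; apply: le_trans.
  by have := rn_coord (q y - y) j; rewrite !mxE.
have zz : cball z (1 / 2) z by rewrite /cball /= subrr rn0; lra.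
have [_ /(_ _)[|_ h]] := hL e fe z zz (z' - z); first lra.
rewrite !mxE; rewrite [z + _]addrC subrK /f in h.
apply: le_trans h _; have := rn_ge0 (z' - z); nra.
Qed.

Lemma near_id_inj (q : V -> V) (r e : R) : e <= 1 / 16 ->
  apxV (cball 0 r) q -> (forall z, rn z <= r -> rn (q z - z) <= e) ->
  forall z z', rn z <= r - 1 -> rn z' <= r - 1 -> q z = q z' -> z = z'.
Proof.
move=> e16 hq qe z z' hz hz' qq; apply/eqP; rewrite -subr_eq0; apply/eqP/rn_eq0.
have := near_id_lipschitz e16 hq qe hz hz'; rewrite qq.
have -> : q z' - z' - (q z' - z) = z - z' by apply/rowP => j; rewrite !mxE; ring.
rewrite rn_sub; have := rn_ge0 (z' - z); lra.
Qed.

(** The contraction [z |-> w - (q z - z)] is iterated from [w]. As functions of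
    [w] the iterates are limits of polynomials, and they converge uniformly; so the
    inverse is again a limit of polynomials. *)
Lemma near_id_inverse (q : V -> V) (r e : R) : e <= 1 / 16 ->
  apxV (cball 0 r) q -> (forall z, rn z <= r -> rn (q z - z) <= e) ->
  exists2 S : V -> V, apxV (cball 0 (r - 2)) S &
    forall w, rn w <= r - 2 -> rn (S w - w) <= e /\ q (S w) = w.
Proof.
move=> e16 hq qe.
pose phi (z : V) : V := q z - z.
pose it := fix it n (w : V) : V := if n is n'.+1 then w - phi (it n' w) else w.
have [r2|r2] := ltP (r - 2) 0.
  exists id; first by move=> j; apply/polyfun_apx/polyfun_coord.
  by move=> w hw; exfalso; have := rn_ge0 w; lra.
have e0 : 0 <= e by apply: le_trans (rn_ge0 _) (qe 0 _); rewrite rn0; lra.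
have itb n w : rn w <= r - 2 -> rn (it n w - w) <= e.
  move=> hw; elim: n => [|n ih]; first by rewrite subrr rn0.
  rewrite /= addrAC subrr add0r rnN; apply: qe.
  by have := rn_tri w (it n w) 0; rewrite !subr0; lra.
have itr n w : rn w <= r - 2 -> rn (it n w) <= r - 1.
  by move=> hw; have := itb n w hw; have := rn_tri w (it n w) 0; rewrite !subr0; lra.
have its n w : rn w <= r - 2 -> rn (it n.+1 w - it n w) <= e * (1 / 2) ^+ n.
  move=> hw; elim: n => [|n ih].
    by rewrite expr0 mulr1; exact: (itb 1%N).
  have -> : it n.+2 w - it n.+1 w = - (phi (it n.+1 w) - phi (it n w)).
    by apply/rowP => j; rewrite /= !mxE; ring.
  rewrite rnN.
  apply: le_trans (near_id_lipschitz e16 hq qe (itr n w hw) (itr n.+1 w hw)) _.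
  by rewrite exprS; lra.
have /choice[S hS] : forall w, exists l, rn w <= r - 2 -> forall n,
    rn (l - it n w) <= 4 * e * (1 / 2) ^+ n.
  move=> w; have [hw|hw] := leP (rn w) (r - 2); last by exists 0.
  by have [l hl] := geometric_cvg (fun n => its n w hw); exists l.
have Sb w : rn w <= r - 2 -> rn (S w - w) <= e.
  move=> hw; apply: (@le_of_half _ _ _ (4 * e)) => n.
  have := rn_tri (it n w) (S w) w; have := itb n w hw; have := hS w hw n; lra.
have Sr w : rn w <= r - 2 -> rn (S w) <= r - 1.
  by move=> hw; have := Sb w hw; have := rn_tri w (S w) 0; rewrite !subr0; lra.
exists S.
  apply: apxV_lim => t t0; have [n hn] := half_pow_small (4 * e) t0.
  exists (it n); last first.
    by move=> w; rewrite cball0E => hw; exact: le_trans (hS w hw n) hn.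
  elim: n {hn} => [|n ih]; first by move=> j; apply/polyfun_apx/polyfun_coord.
  have hphi : apxV (cball 0 r) phi.
    move=> j; apply: (@apx_ext _ _ _ (fun u => q u ord0 j - u ord0 j)).
      by move=> u _; rewrite !mxE.
    by apply: apx_add; [exact: hq|apply/polyfun_apx/polyfun_opp/polyfun_coord].
  have h := @apxV_comp _ _ (cball 0 (r - 2)) (cball 0 r) phi (it n) (r - 1) hphi ih.
  move=> j; apply: (@apx_ext _ _ _ (fun u => u ord0 j - phi (it n u) ord0 j)).
    by move=> u _; rewrite /= !mxE.
  apply: apx_add; first by apply/polyfun_apx/polyfun_coord.
  apply/apx_opp/h => u; rewrite !cball0E => hu.
  by have := itr n u hu; split; lra.
move=> w hw; split; first exact: Sb.
apply/eqP; rewrite -subr_eq0; apply/eqP/rn_eq0/eqP; rewrite eq_le rn_ge0 andbT.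
apply: (@le_of_half _ _ _ (4 * e)) => n; rewrite add0r.
have h1 := near_id_lipschitz e16 hq qe (itr n w hw) (Sr w hw).
have h2 : q (S w) - w = (S w - it n.+1 w) + (phi (S w) - phi (it n w)).
  rewrite /= /phi; move: (q (S w)) (q (it n w)) (it n w) (S w) => a b c d.
  by rewrite -[LHS]addr0; apply/rowP => j; rewrite !mxE; ring.
have h3 := hS w hw n; have h4 := hS w hw n.+1; rewrite exprS in h4.
rewrite h2; apply: le_trans (rnD _ _) _; rewrite /phi; lra.
Qed.

End Automorphisms.

(** * The complex exponential *)

Section ComplexExp.
Context {R : realType}.
Local Notation C := (Cplx R).

Definition cexp (z : C) : C :=
  let: Complex x y := (z : R[i]) in Complex (expR x * cos y) (expR x * sin y).

Lemma cexpD (z w : C) : cexp (z + w) = cexp z * cexp w.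
Proof.
case: z => a b; case: w => c d; rewrite /cexp /=.
rewrite expRD cosD sinD; congr Complex; ring.
Qed.

Lemma cexp0 : cexp 0 = 1.
Proof. by rewrite /cexp /= expR0 cos0 sin0 mulr1 mulr0. Qed.

Lemma cexpNM (z : C) : cexp (- z) * cexp z = 1.
Proof. by rewrite -cexpD addNr cexp0. Qed.

Lemma cexpMn (z : C) n : cexp (z *+ n) = cexp z ^+ n.
Proof. by elim: n => [|n ih]; rewrite ?mulr0n ?cexp0// mulrS cexpD ih exprS. Qed.

Lemma rn_cexp (z : C) : rn (cexp z) = expR (complex.Re (z : R[i])).
Proof.
case: z => x y; apply: cRI; rewrite -rnE normc_def /=; congr ((_)%:C)%C.
rewrite !exprMn -mulrDr cos2Dsin2 mulr1 sqrtr_sqr ger0_norm// expR_ge0.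
Qed.

Lemma rn_cexp_le (z : C) : rn (cexp z) <= expR (rn z).
Proof. by rewrite rn_cexp ler_expR; apply: le_trans (ler_norm _) (rn_Re _). Qed.

Lemma is_derive_estimate (f : R -> R) (d : R) : is_derive (0 : R) (1 : R) f d ->
  forall e : R, 0 < e -> exists2 t : R, 0 < t &
    forall h, `|h| <= t -> `|f h - f 0 - d * h| <= e * `|h|.
Proof.
move=> [df dE] e e0.
have /eqaddoP /(_ _ e0) := derivable_nbhs df.
move=> /nbhs_ballP[t t0 ht]; exists (t / 2); first by rewrite divr_gt0.
move=> h hh; have := ht h; rewrite -ball_normE /= sub0r normrN.
have ht2 : `|h| < t by have : 0 < t := t0; lra.
move=> /(_ ht2); congr (`|_| <= _).
rewrite -[LHS]/(f (h *: 1 + 0) - (f 0 + h *: 'D_1 f 0)) dE addr0.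
have -> : h *: (1 : R) = h by rewrite -[h *: 1]/(h * 1) mulr1.
by rewrite -[h *: d]/(h * d); ring.
Qed.

Lemma cexp_first_order (e : R) : 0 < e -> exists2 d : R, 0 < d &
  forall z : C, rn z <= d -> rn (cexp z - 1 - z : C) <= e * rn z.
Proof.
move=> e0; pose t := Num.min 1 (e / 8).
have t0 : 0 < t by rewrite /t lt_min ltr01 divr_gt0.
have t1 : t <= 1 by rewrite /t ge_min lexx.
have te : t <= e / 8 by rewrite /t ge_min lexx orbT.
have [d1 d10 h1] := is_derive_estimate (is_derive_expR (0 : R)) t0.
have [d2 d20 h2] := is_derive_estimate (is_derive_cos (0 : R)) t0.
have [d3 d30 h3] := is_derive_estimate (is_derive_sin (0 : R)) t0.
rewrite expR0 in h1; rewrite cos0 sin0 in h2 h3.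
exists (Num.min (t / 2) (Num.min d1 (Num.min d2 d3))).
  by rewrite !lt_min d10 d20 d30 divr_gt0.
move=> z; rewrite !le_min => /and4P[z0 z1 z2 z3].
have xz := rn_Re z; have yz := rn_Im z.
have {}h1 := h1 _ (le_trans xz z1).
have {}h2 := h2 _ (le_trans yz z2).
have {}h3 := h3 _ (le_trans yz z3).
case: z => x y in z0 z1 z2 z3 xz yz h1 h2 h3 *; rewrite /= in xz yz h1 h2 h3.
set r := rn _ in z0 z1 z2 z3 xz yz *.
rewrite oppr0 mul0r subr0 in h2; rewrite subr0 mul1r in h3; rewrite mul1r in h1.
apply: le_trans (rn_ReIm _) _ => /=.
set E := expR x in h1 *; set c := cos y in h2 *; set s := sin y in h3 *.
have E1 : `|E - 1| <= t.
  have -> : E - 1 = (E - 1 - x) + x by ring.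
  by apply: le_trans (ler_normD _ _) _; have := normr_ge0 x; nra.
have E2 : 0 <= E <= 2.
  by rewrite expR_ge0/=; move: E1; rewrite ler_norml => /andP[_]; lra.
have -> : E * c - 1 - x = (E - 1 - x) + E * (c - 1) by ring.
have -> : E * s - 0 - y = E * (s - y) + (E - 1) * y by ring.
have a1 := ler_normD (E - 1 - x) (E * (c - 1)).
have a2 := ler_normD (E * (s - y)) ((E - 1) * y).
rewrite !normrM in a1 a2.
move: E2 => /andP[E2 E3].
rewrite (ger0_norm E2) in a1 a2.
have b1 : E * `|c - 1| <= 2 * (t * `|y|) by apply: ler_pM.
have b2 : E * `|s - y| <= 2 * (t * `|y|) by apply: ler_pM.
have b3 : `|E - 1| * `|y| <= t * `|y| by apply: ler_wpM2r.
have b4 : t * `|y| <= t * r by rewrite ler_wpM2l// ltW.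
have b5 : t * `|x| <= t * r by rewrite ler_wpM2l// ltW.
have b6 : t * r <= e / 8 * r by rewrite ler_wpM2r// rn_ge0.
have b7 : 0 <= e * r by rewrite mulr_ge0 ?rn_ge0 ?(ltW e0).
lra.
Qed.

Lemma pow_diff_bound (a b : C) (m : R) n : 1 <= m -> rn a <= m -> rn b <= m ->
  rn (a ^+ n - b ^+ n : C) <= n%:R * m ^+ n * rn (a - b : C).
Proof.
move=> m1 am bm; rewrite subrXX rnM mulrC ler_wpM2r ?rn_ge0//.
apply: le_trans (rn_sum _ _ _) _.
apply: (@le_trans _ _ (\sum_(i < n) m ^+ n)); last by rewrite sumr_const card_ord mulr_natl.
apply: ler_sum => i _; rewrite rnM !rnX.
have m0 : 0 <= m by lra.
apply: (@le_trans _ _ (m ^+ (n.-1 - i) * m ^+ i)).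
  by apply: ler_pM; rewrite ?exprn_ge0 ?rn_ge0// lerXn2r ?nnegrE ?rn_ge0.
by rewrite -exprD ler_weXn2l//; have := ltn_ord i; lia.
Qed.

(** Write [cexp z] as the [N]-th power of [cexp (z / N)]. The bases [cexp (z / N)]
    and [1 + z / N] differ by [o(1 / N)] and are bounded by [expR (r / N)], so
    their [N]-th powers differ by [o(1)]. *)
Lemma cexp_limit (r e : R) : 0 < e -> exists n : nat,
  forall z : C, rn z <= r -> rn (cexp z - (1 + z / n.+1%:R) ^+ n.+1 : C) <= e.
Proof.
move=> e0; pose r' := `|r| + 1; have r0 : 0 < r' by rewrite ltr_wpDl.
have rr : r <= r' by have := ler_norm r; rewrite /r'; lra.
clearbody r'.
have E0 : 0 < expR r' by exact: expR_gt0.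
have t0 : 0 < e / (r' * expR r') by rewrite divr_gt0// mulr_gt0.
have [d d0 hd] := cexp_first_order t0.
have [n hn] := @invS_small R (d / r') (divr_gt0 d0 r0).
exists n => z hz; have {}hn := hn n (leqnn n).
have N0 : 0 < n.+1%:R :> R by rewrite ltr0n.
have NC : n.+1%:R = cR n.+1%:R :> C by rewrite /cR rmorph_nat.
have rnz : rn (z / n.+1%:R : C) = rn z / n.+1%:R.
  by rewrite rnM rnV NC rn_cR ger0_norm// ltW.
have zN : cexp z = cexp (z / n.+1%:R) ^+ n.+1.
  by rewrite -cexpMn -[(z / _) *+ _]mulr_natr divfK// pnatr_eq0.
rewrite zN; set w := z / _ in rnz *.
have wr : rn w <= r' / n.+1%:R.
  by rewrite rnz; apply: ler_wpM2r; [rewrite invr_ge0 ltW|exact: le_trans rr].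
pose m := expR (r' / n.+1%:R).
have m1 : 1 <= m.
  have h1 := expR_ge1Dx (r' / n.+1%:R); have h2 := divr_gt0 r0 N0.
  by rewrite /m; apply: le_trans h1; rewrite lerDl ltW.
have mN : m ^+ n.+1 = expR r' by rewrite -expRM_natl mulrC divfK// gt_eqF.
have A : rn (cexp w) <= m by apply: le_trans (rn_cexp_le _) _; rewrite ler_expR.
have B : rn (1 + w : C) <= m.
  apply: le_trans (rnD _ _) _; rewrite rn1.
  by apply: le_trans (expR_ge1Dx (r' / n.+1%:R)); rewrite lerD2l.
have wd : rn w <= d.
  apply: le_trans wr _; rewrite ler_pdivlMr// in hn.
  by rewrite mulrC.
apply: le_trans (pow_diff_bound _ m1 A B) _.
rewrite opprD addrA mN.
have h : rn (cexp w - 1 - w : C) <= e / (r' * expR r') * (r' / n.+1%:R).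
  by apply: le_trans (hd w wd) _; rewrite ler_wpM2l// ltW.
apply: le_trans (ler_wpM2l _ h) _; first by rewrite mulr_ge0// ltW.
rewrite le_eqVlt; apply/orP; left; apply/eqP.
by field; rewrite !gt_eqF.
Qed.

Lemma apx_cexp {k : nat} (p : 'rV[C]_k -> C) r : polyfun p ->
  apx (cball 0 r) (fun u => cexp (p u)).
Proof.
move=> pp; apply: apx_lim => e e0; have [B B0 hB] := polyfun_bounded r pp.
have [n hn] := cexp_limit B e0.
exists (fun u => (1 + p u / n.+1%:R) ^+ n.+1); last first.
  by move=> u; rewrite cball0E => /hB/hn.
apply/polyfun_apx/polyfun_exp/polyfun_add; first exact: polyfun_cst.
by apply: polyfun_mul => //; exact: polyfun_cst.
Qed.

Lemma apx_mul_polyfun {k : nat} (f p : 'rV[C]_k -> C) r : polyfun p ->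
  apx (cball 0 r) f -> apx (cball 0 r) (fun u => f u * p u).
Proof.
move=> pp hf e e0; have [B B0 hB] := polyfun_bounded r pp.
have B1 : 0 < B + 1 by rewrite ltr_wpDl.
have [q pq hq] := hf _ (divr_gt0 e0 B1).
exists (fun u => q u * p u); first exact: polyfun_mul.
move=> u hu; rewrite -mulrBl rnM; have := hq u hu; rewrite ler_pdivlMr//.
rewrite cball0E in hu; have := hB u hu.
by have := rn_ge0 (p u); have := rn_ge0 (f u - q u : C); nra.
Qed.
End ComplexExp.

(** * Polynomial fields and automorphisms *)

Section Flowable.
Context {R : realType} {k : nat}.
Local Notation C := (Cplx R).
Local Notation V := 'rV[C]_k.

(** Fields tangent to the group of automorphisms: a step [h *: Q u] can be corrected
    to an automorphism with an error small with respect to [h]. Complex steps make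
    the notion stable under complex scaling. *)
Definition flowable (Q : V -> V) : Prop :=
  (forall j, polyfun (fun u => Q u ord0 j)) /\
  forall r e : R, 0 < e -> exists2 d : R, 0 < d & forall h : C, rn h <= d ->
    exists s t, aut s t /\ forall u, rn u <= r -> rn (s u - u - h *: Q u) <= e * rn h.

Lemma flowable_scale (c : C) Q : flowable Q -> flowable (fun u => c *: Q u).
Proof.
move=> [pQ hQ]; split=> [j|r e e0].
  rewrite (_ : (fun u => _) = (fun u => c * Q u ord0 j)).
    by apply: polyfun_mul => //; exact: polyfun_cst.
  by apply/funext => u; rewrite mxE.
have c1 : 0 < rn c + 1 by rewrite ltr_wpDl// rn_ge0.
have [d d0 hd] := hQ r _ (divr_gt0 e0 c1).
exists (d / (rn c + 1)); first exact: divr_gt0.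
move=> h; rewrite ler_pdivlMr// => hh.
have [|s [t [st hs]]] := hd (h * c).
  by rewrite rnM; have := rn_ge0 h; nra.
exists s, t; split=> // u hu; rewrite scalerA; apply: le_trans (hs u hu) _.
rewrite rnM mulrAC ler_pdivrMr// -mulrA ler_wpM2l ?(ltW e0)//.
by have := rn_ge0 h; nra.
Qed.

Lemma polyfunV_bounded (Q : V -> V) (r : R) : (forall j, polyfun (fun u => Q u ord0 j)) ->
  exists2 B : R, 0 <= B & forall u, rn u <= r -> rn (Q u) <= B.
Proof. by move=> hQ; apply: entV_bounded; exact: entV_polyfun. Qed.

Lemma polyfunV_unif (Q : V -> V) (M e : R) : (forall j, polyfun (fun u => Q u ord0 j)) ->
  0 < e ->
  exists2 d : R, 0 < d & forall u v, rn u <= M -> rn (v - u) <= d -> rn (Q v - Q u) <= e.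
Proof.
move=> hQ e0.
have hc u : cball 0 M u -> {for u, continuous Q}.
  by move=> _; apply: entV_continuous; exact: entV_polyfun.
have [d d0 hd] := compact_unif_continuous (@cball_compact R k 0 M) hc e0.
exists d; first exact: d0.
move=> u v hu; have cu : cball 0 M u by rewrite cball0E.
exact: (hd u v cu).
Qed.

(** Compose the automorphisms attached to the two fields; by uniform continuity
    the second field changes little at the displaced point. *)
Lemma flowable_add Q Q' : flowable Q -> flowable Q' -> flowable (fun u => Q u + Q' u).
Proof.
move=> [pQ hQ] [pQ' hQ']; split=> [j|r e e0].
  rewrite (_ : (fun u => _) = (fun u => Q u ord0 j + Q' u ord0 j)).
    exact: polyfun_add.
  by apply/funext => u; rewrite mxE.
have [B B0 hB] := polyfunV_bounded r pQ.
have e3 : 0 < e / 3 by rewrite divr_gt0.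
have [d1 d10 h1] := hQ r _ e3.
have [d2 d20 h2] := hQ' (r + 1) _ e3.
have [d3 d30 h3] := polyfunV_unif r pQ' e3.
pose b := B + e; have b0 : 0 < b by rewrite /b; lra.
pose m := Num.min 1 d3; have m0 : 0 < m by rewrite /m lt_min ltr01.
exists (Num.min d1 (Num.min d2 (m / b))).
  by rewrite !lt_min d10 d20 divr_gt0.
move=> h; rewrite !le_min ler_pdivlMr// => /and3P[hh1 hh2 hh3].
have [s [t [st hs]]] := h1 h hh1; have [s' [t' [st' hs']]] := h2 h hh2.
exists (s' \o s), (t \o t'); split; first exact: aut_comp.
move=> u hu /=; have h0 := rn_ge0 h.
have su : rn (s u - u) <= m.
  have -> : s u - u = (s u - u - h *: Q u) + h *: Q u by rewrite subrK.
  apply: le_trans (rnD _ _) _; rewrite rnZ.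
  have := hs u hu; have := hB u hu; rewrite /b in hh3; nra.
have sur : rn (s u) <= r + 1.
  have := rn_tri u (s u) 0; rewrite !subr0; move: su; rewrite /m le_min => /andP[]; lra.
have -> : s' (s u) - u - h *: (Q u + Q' u) = (s' (s u) - s u - h *: Q' (s u)) +
   (s u - u - h *: Q u) + h *: (Q' (s u) - Q' u).
  by apply/rowP => j; rewrite !mxE; ring.
apply: le_trans (rnD _ _) _; rewrite rnZ.
have a1 := rnD (s' (s u) - s u - h *: Q' (s u)) (s u - u - h *: Q u).
have a2 := hs u hu; have a3 := hs' _ sur.
have a4 : rn (Q' (s u) - Q' u) <= e / 3.
  by apply: (h3 _ _ hu); apply: le_trans su _; rewrite /m ge_min lexx orbT.
apply: le_trans (lerD (le_trans a1 (lerD a3 a2)) (ler_wpM2l h0 a4)) _.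
by rewrite le_eqVlt; apply/orP; left; apply/eqP; field.
Qed.

Lemma flowable0 : flowable (fun _ => 0).
Proof.
split=> [j|r e e0].
  rewrite (_ : (fun u => _) = (fun u => 0)); first exact: polyfun_cst.
  by apply/funext => u; rewrite mxE.
exists 1 => // h _; exists id, id; split; first exact: aut_id.
by move=> u _; rewrite subrr scaler0 subr0 rn0 mulr_ge0// ?rn_ge0 ?ltW.
Qed.

Lemma flowable_sum I (r : seq I) (P : pred I) (F : I -> V -> V) :
  (forall i, P i -> flowable (F i)) -> flowable (fun u => \sum_(i <- r | P i) F i u).
Proof.
move=> hF; elim: r => [|i r ih].
  rewrite (_ : (fun u => _) = (fun u => 0)); first exact: flowable0.
  by apply/funext => u; rewrite big_nil.
have [Pi|Pi] := boolP (P i).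
  rewrite (_ : (fun u => _) = (fun u => F i u + \sum_(j <- r | P j) F j u)).
    by apply: flowable_add => //; exact: hF.
  by apply/funext => u; rewrite big_cons Pi.
rewrite (_ : (fun u => _) = (fun u => \sum_(j <- r | P j) F j u)) //.
by apply/funext => u; rewrite big_cons (negPf Pi).
Qed.

Lemma flowable_sub Q Q' : flowable Q -> flowable Q' -> flowable (fun u => Q u - Q' u).
Proof.
move=> hQ hQ'; rewrite (_ : (fun u => _) = (fun u => Q u + -1 *: Q' u)).
  by apply: flowable_add => //; exact: flowable_scale.
by apply/funext => u; rewrite scaleN1r.
Qed.

Definition invariant_along (v : V) (f : V -> C) := forall u (a : C), f (u + a *: v) = f u.

(** The field is constant along its own orbits, so the exact flow is
    [u |-> u + (h * f u) *: v]. *)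
Lemma flowable_shear f v : polyfun f -> invariant_along v f -> flowable (fun u => f u *: v).
Proof.
move=> pf fv; split=> [j|r e e0].
  rewrite (_ : (fun u => _) = (fun u => f u * v ord0 j)).
    by apply: polyfun_mul => //; exact: polyfun_cst.
  by apply/funext => u; rewrite mxE.
have ent (h : C) : entV (fun u => u + (h * f u) *: v).
  apply: entV_polyfun => j.
  rewrite (_ : (fun u => _) = (fun u : V => u ord0 j + h * f u * v ord0 j)).
    apply: polyfun_add; first exact: polyfun_coord.
    by repeat (apply: polyfun_mul => //); exact: polyfun_cst.
  by apply/funext => u; rewrite !mxE.
exists 1 => // h _; exists (fun u => u + (h * f u) *: v), (fun u => u + (- h * f u) *: v).
split; first split => //.
- by move=> u; rewrite fv mulNr scaleNr addrK.
- by move=> u; rewrite fv mulNr scaleNr subrK.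
move=> u _; rewrite scalerA [u + _]addrC addrK subrr rn0.
by rewrite mulr_ge0// ?rn_ge0 ?ltW.
Qed.

(** On an orbit [f] is constant and the [i]-th coordinate satisfies a linear equation
    with coefficient [f u]; the exact flow multiplies that coordinate by
    [cexp (h * f u)]. *)
Lemma flowable_overshear f v i : polyfun f -> invariant_along v f -> v ord0 i = 1 ->
  flowable (fun u => (f u * u ord0 i) *: v).
Proof.
move=> pf fv vi; split=> [j|r e e0].
  rewrite (_ : (fun u => _) = (fun u => f u * u ord0 i * v ord0 j)).
    apply: polyfun_mul; last exact: polyfun_cst.
    by apply: polyfun_mul => //; exact: polyfun_coord.
  by apply/funext => u; rewrite mxE.
pose s (h : C) u := u + ((cexp (h * f u) - 1) * u ord0 i) *: v.
have ent (h : C) : entV (s h).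
  move=> r' j; apply: (@apx_ext _ _ _
    (fun u : V => u ord0 j + (cexp (h * f u) - 1) * (u ord0 i * v ord0 j))).
    by move=> u _; rewrite /s !mxE mulrA.
  apply: apx_add; first by apply/polyfun_apx/polyfun_coord.
  apply: apx_mul_polyfun.
    by apply: polyfun_mul; [exact: polyfun_coord|exact: polyfun_cst].
  apply: apx_add; last by apply/polyfun_apx/polyfun_cst.
  by apply: apx_cexp; apply: polyfun_mul => //; exact: polyfun_cst.
have sK (h : C) : cancel (s h) (s (- h)).
  move=> u; rewrite /s fv !mxE vi mulr1 -addrA -scalerDl.
  set E := cexp (h * f u); have hE : cexp (- h * f u) * E = 1 by rewrite mulNr cexpNM.
  rewrite [X in X *: v](_ : _ = 0) ?scale0r ?addr0//.
  transitivity ((cexp (- h * f u) * E - 1) * u ord0 i); first ring.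
  by rewrite hE subrr mul0r.
have [B B0 hB] := polyfun_bounded r pf.
have r1 : 0 < `|r| + 1 by rewrite ltr_wpDl.
have v1 : 0 < rn v + 1 by rewrite ltr_wpDl ?rn_ge0.
have B1 : 0 < B + 1 by rewrite ltr_wpDl.
have N0 : 0 < (`|r| + 1) * (rn v + 1) * (B + 1) by rewrite !mulr_gt0.
have [d d0 hd] := @cexp_first_order R _ (divr_gt0 e0 N0).
exists (d / (B + 1)); first exact: divr_gt0.
move=> h; rewrite ler_pdivlMr// => hh; exists (s h), (s (- h)).
have h0 := rn_ge0 h.
split; first by split => //; have := sK (- h); rewrite opprK.
move=> u hu.
have -> : s h u - u - h *: ((f u * u ord0 i) *: v) =
    ((cexp (h * f u) - 1 - h * f u) * u ord0 i) *: v.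
  by apply/rowP => j; rewrite /s !mxE; ring.
have fB := hB u hu; have f0 := rn_ge0 (f u : C).
have hfu : rn (h * f u : C) <= d by rewrite rnM; nra.
have {hd hfu}hx := hd _ hfu.
rewrite rnZ rnM; set x := rn _ in hx *.
have x0 : 0 <= x by exact: rn_ge0.
have uj : rn (u ord0 i : C) <= `|r| + 1.
  by apply: le_trans (rn_coord u i) _; have := ler_norm r; lra.
have u0 := rn_ge0 (u ord0 i : C).
set c := e / _ in hx *; have c0 : 0 < c by rewrite divr_gt0.
have y1 : x <= c * (rn h * (B + 1)).
  by apply: le_trans hx _; rewrite rnM ler_wpM2l// ?(ltW c0)// ler_wpM2l//; lra.
have y2 : x * rn (u ord0 i : C) * rn v <= c * (rn h * (B + 1)) * (`|r| + 1) * (rn v + 1).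
  have := rn_ge0 v => v0; apply: ler_pM => //; first exact: mulr_ge0.
    exact: ler_pM.
  by rewrite lerDl.
apply: le_trans y2 _; rewrite le_eqVlt; apply/orP; left; apply/eqP.
by rewrite /c; field; rewrite !gt_eqF.
Qed.

(** Inverting a Vandermonde matrix, the coefficients of a polynomial in [c] are
    linear combinations of its values at [0, ..., n - 1]. *)
Lemma flowable_coef (n : nat) (X : nat -> V -> V) :
  (forall c : C, flowable (fun u => \sum_(a < n) c ^+ a *: X a u)) ->
  forall a, (a < n)%N -> flowable (X a).
Proof.
move=> hX a an.
pose nodes : 'rV[C]_n := \row_l (l : nat)%:R.
pose A : 'M[C]_n := Vandermonde n nodes.
have Au : A \in unitmx.
  rewrite unitmxE det_Vandermonde unitfE; apply/prodf_neq0 => i _.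
  apply/prodf_neq0 => j ij; rewrite !mxE subr_eq0 eqr_nat.
  by rewrite gt_eqF.
pose w (l : 'I_n) : C := invmx A l (Ordinal an).
have hw (m : 'I_n) : \sum_(l < n) (l : nat)%:R ^+ m * w l = (m == Ordinal an)%:R :> C.
  have := mulmxV Au => /matrixP /(_ m (Ordinal an)); rewrite !mxE => <-.
  by apply: eq_bigr => l _; rewrite !mxE.
rewrite (_ : X a = fun u => \sum_(l < n) w l *: \sum_(m < n) (l : nat)%:R ^+ m *: X m u).
  by apply: flowable_sum => l _; apply: flowable_scale; exact: hX.
apply/funext => u; under eq_bigr do rewrite scaler_sumr.
rewrite exchange_big /=.
under eq_bigr do (under eq_bigr do rewrite scalerA mulrC; rewrite -scaler_suml hw).
rewrite (bigD1 (Ordinal an))//= eqxx scale1r big1 ?addr0// => m /negPf ->.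
by rewrite scale0r.
Qed.

Section Plane.
Variables (i j : 'I_k) (M : V -> C).
Hypothesis ij : i != j.
Hypothesis pM : polyfun M.
Hypothesis Mi : invariant_along (delta_mx 0 i) M.
Hypothesis Mj : invariant_along (delta_mx 0 j) M.
Let x (u : V) := u ord0 i.
Let y (u : V) := u ord0 j.
Let P d a (u : V) : C := 'C(d, a)%:R * (x u ^+ a * y u ^+ (d - a) * M u).
Let ei : V := delta_mx 0 i.
Let ej : V := delta_mx 0 j.
(** Coefficient of [c ^+ a] in the shear field along [ei - c *: ej] with factor
    [(y u + c * x u) ^+ d * M u]. *)
Let Xd d a (u : V) : V := P d a u *: ei - (if a is a'.+1 then P d a' u *: ej else 0).

Let XdE d (c : C) u : \sum_(a < d.+2) c ^+ a *: Xd d a u =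
   ((y u + c * x u) ^+ d * M u) *: (ei - c *: ej).
Proof.
have hP : \sum_(a < d.+1) c ^+ a * P d a u = (y u + c * x u) ^+ d * M u.
  rewrite exprDn mulr_suml; apply: eq_bigr => a _.
  by rewrite /P exprMn -mulr_natl; ring.
have -> : \sum_(a < d.+2) c ^+ a *: Xd d a u =
   \sum_(a < d.+2) (c ^+ a * P d a u) *: ei -
   \sum_(a < d.+2) (if (a : nat) is a'.+1 then (c ^+ a * P d a' u) *: ej else 0).
  rewrite -sumrB; apply: eq_bigr => -[[|a] ha] _ /=; rewrite /Xd.
    by rewrite !subr0 scalerA.
  by rewrite scalerBr !scalerA.
rewrite big_ord_recr /= [P d d.+1 u]/P bin_small ?mul0r ?mulr0 ?scale0r ?addr0//.
rewrite -scaler_suml hP big_ord_recl /= add0r.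
rewrite (eq_bigr (fun a : 'I_d.+1 => (c * (c ^+ a * P d a u)) *: ej)); last first.
  by move=> a _; rewrite /bump /= exprS mulrA.
rewrite -scaler_suml -mulr_sumr hP scalerBr scalerA; congr (_ - _ *: _).
exact: mulrC.
Qed.

Let inv_lin (c : C) d : invariant_along (ei - c *: ej) (fun u => (y u + c * x u) ^+ d * M u).
Proof.
move=> u a.
have -> : M (u + a *: (ei - c *: ej)) = M u.
  by rewrite scalerBr scalerA -scaleNr addrA Mj Mi.
congr (_ ^+ d * _); rewrite /x /y !mxE !eqxx /= [j == i]eq_sym (negPf ij) /=.
by ring.
Qed.

Let pol_lin (c : C) d : polyfun (fun u => (y u + c * x u) ^+ d * M u).
Proof.
apply: polyfun_mul => //; apply: polyfun_exp; apply: polyfun_add.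
  exact: polyfun_coord.
by apply: polyfun_mul; [exact: polyfun_cst|exact: polyfun_coord].
Qed.

Let shear_coef d a : (a < d.+2)%N -> flowable (Xd d a).
Proof.
apply: flowable_coef => c; rewrite (funext (XdE d c)).
exact: (flowable_shear (pol_lin c d) (@inv_lin c d)).
Qed.

Let overshear_coef d a : (a < d.+2)%N -> flowable (fun u => x u *: Xd d a u).
Proof.
apply: (@flowable_coef _ (fun a u => x u *: Xd d a u)) => c.
have -> : (fun u => \sum_(a < d.+2) c ^+ a *: (x u *: Xd d a u)) =
    (fun u => (((y u + c * x u) ^+ d * M u) * u ord0 i) *: (ei - c *: ej)).
  apply/funext => u; rewrite [_ * u ord0 i]mulrC -scalerA -XdE scaler_sumr.
  by apply: eq_bigr => b _; rewrite !scalerA mulrC.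
apply: (flowable_overshear (pol_lin c d) (@inv_lin c d)).
by rewrite !mxE !eqxx /= (negPf ij) mulr0 subr0.
Qed.

(** For [a >= 2], the coefficients of [c] extracted from the shears with exponent
    [a + b] and from the overshears with exponent [a + b - 1] are two combinations
    of the same two monomial fields, one along [ei] and one along [ej], with
    nonzero determinant. *)
Lemma flowable_plane a b : flowable (fun u => (x u ^+ a * y u ^+ b * M u) *: ei).
Proof.
case: a => [|[|a]].
- have h := @shear_coef b 0 isT; rewrite (_ : (fun u => _) = Xd b 0)//.
  by apply/funext => u; rewrite /Xd /P bin0 subn0 subr0 !mul1r.
- have h := @overshear_coef b 0 isT.
  rewrite (_ : (fun u => _) = (fun u => x u *: Xd b 0 u))//.
  by apply/funext => u; rewrite /Xd /P bin0 subn0 subr0 scalerA; congr (_ *: _); ring.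
pose d := (a + b).+1.
have h1 : flowable (Xd d.+1 a.+2) by apply: shear_coef; rewrite /d; lia.
have h2 : flowable (fun u => x u *: Xd d a.+1 u) by apply: overshear_coef; rewrite /d; lia.
pose p : nat := 'C(d.+1, a.+2); pose q : nat := 'C(d.+1, a.+1).
pose p' : nat := 'C(d, a.+1); pose q' : nat := 'C(d, a).
have e1 : (d.+1 * p' = a.+2 * p)%N by rewrite /p' /p mul_bin_diag.
have e2 : (d.+1 * q' = a.+1 * q)%N by rewrite /q' /q mul_bin_diag.
have p0 : (0 < p)%N by rewrite bin_gt0 /d; lia.
have q0 : (0 < q)%N by rewrite bin_gt0 /d; lia.
(* The determinant is nonzero: up to [d + 1], the two products are [a + 1] and
   [a + 2] times [p * q]. *)
have pq : (p * q' < q * p')%N.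
  rewrite -(ltn_pmul2l (ltn0Sn d)) mulnCA e2 mulnCA [in X in (_ < X)%N]mulnCA e1; nia.
have D0 : (q'%:R * p%:R - q%:R * p'%:R : C) != 0.
  by rewrite -!natrM subr_eq0 eqr_nat mulnC ltn_eqF.
have := flowable_scale (q'%:R * p%:R - q%:R * p'%:R)^-1
   (flowable_sub (flowable_scale q'%:R h1) (flowable_scale q%:R h2)).
congr flowable; apply/funext => u.
rewrite /Xd /P -/p -/q -/p' -/q'.
have -> : (d.+1 - a.+2 = b)%N by rewrite /d; lia.
have -> : (d.+1 - a.+1 = b.+1)%N by rewrite /d; lia.
have -> : (d - a.+1 = b)%N by rewrite /d; lia.
have -> : (d - a = b.+1)%N by rewrite /d; lia.
move: (x u) (y u) (M u) (ei : V) (ej : V) => X Y m E F.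
by apply/rowP => l; rewrite !mxE !exprS; field.
Qed.
End Plane.

Lemma flowable_monomial (m : 'I_k -> nat) (i : 'I_k) : (2 <= k)%N ->
  flowable (fun u => (\prod_l u ord0 l ^+ m l) *: delta_mx 0 i).
Proof.
move=> k2.
have [j ij] : exists j, i != j.
  have k0 : (0 < k)%N by lia.
  have [->|i0] := eqVneq i (Ordinal k0); last by exists (Ordinal k0).
  by exists (Ordinal k2); rewrite -val_eqE.
pose M (u : V) := \prod_(l | (l != i) && (l != j)) u ord0 l ^+ m l.
have pM : polyfun M by apply: polyfun_prod => l; apply: polyfun_exp; exact: polyfun_coord.
have inv t : (t == i) || (t == j) -> invariant_along (delta_mx 0 t) M.
  move=> ht u a; apply: eq_bigr => l /andP[li lj].
  rewrite !mxE eqxx /=; have /negPf -> : l != t.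
    by apply: contraTneq ht => <-; rewrite negb_or li.
  by rewrite mulr0 addr0.
have := @flowable_plane i j M ij pM (inv i _) (inv j _) (m i) (m j).
rewrite !eqxx orbT => /(_ isT isT); congr flowable; apply/funext => u.
by rewrite [in RHS](bigD1 i)//= (bigD1 j)/= 1?eq_sym// mulrA.
Qed.

Lemma flowable_peval (p : 'I_k -> mpoly.mpoly k C) : (2 <= k)%N ->
  flowable (fun u => \row_j peval (p j) u).
Proof.
move=> k2.
rewrite (_ : (fun u : V => _) = fun u : V => \sum_j \sum_(m <- mpoly.msupp (p j))
   mpoly.mcoeff m (p j) *: ((\prod_l u ord0 l ^+ mpoly.fun_of_multinom m l) *: delta_mx 0 j)).
  apply: flowable_sum => j _; apply: flowable_sum => m _; apply: flowable_scale.
  exact: flowable_monomial.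
apply/funext => u; rewrite [LHS]row_sum_delta; apply: eq_bigr => j _.
rewrite mxE pevalE scaler_suml; apply: eq_bigr => m _.
by rewrite scalerA.
Qed.

End Flowable.

(** * Approximation of biholomorphic maps by automorphisms *)

Section DiffBig.
Context {R : realType} {V : normedModType (Cplx R)}.
Local Notation C := (Cplx R).

Lemma differentiable_bigsum (I : Type) (s : seq I) (P : pred I) (F : I -> V -> C) u :
  (forall i, differentiable (F i) u) ->
  differentiable (fun v => \sum_(i <- s | P i) F i v) u.
Proof.
move=> hF; elim: s => [|i s ih].
  rewrite (_ : (fun v => _) = cst 0); first exact: differentiable_cst.
  by apply/funext => v; rewrite big_nil.
case Pi: (P i).
  rewrite (_ : (fun v => _) = F i + (fun v => \sum_(j <- s | P j) F j v)).
    exact: differentiableD.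
  by apply/funext => v; rewrite big_cons Pi.
rewrite (_ : (fun v => _) = (fun v => \sum_(j <- s | P j) F j v))//.
by apply/funext => v; rewrite big_cons Pi.
Qed.

Lemma differentiable_bigprod (I : Type) (s : seq I) (P : pred I) (F : I -> V -> C) u :
  (forall i, differentiable (F i) u) ->
  differentiable (fun v => \prod_(i <- s | P i) F i v) u.
Proof.
move=> hF; elim: s => [|i s ih].
  rewrite (_ : (fun v => _) = cst 1); first exact: differentiable_cst.
  by apply/funext => v; rewrite big_nil.
case Pi: (P i).
  rewrite (_ : (fun v => _) = F i * (fun v => \prod_(j <- s | P j) F j v)).
    exact: differentiableM.
  by apply/funext => v; rewrite big_cons Pi.
rewrite (_ : (fun v => _) = (fun v => \prod_(j <- s | P j) F j v))//.
by apply/funext => v; rewrite big_cons Pi.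
Qed.

Lemma differentiable_mul (f g : V -> C) u : differentiable f u -> differentiable g u ->
  differentiable (fun v => f v * g v) u.
Proof. by move=> hf hg; exact: (differentiableM hf hg). Qed.

Lemma differentiable_det n (A : V -> 'M[C]_n) u :
  (forall i j, differentiable (fun v => A v i j : C) u) ->
  differentiable (fun v => \det (A v) : C) u.
Proof.
move=> hA; rewrite /determinant; apply: differentiable_bigsum => s.
apply: differentiable_mul; first exact: differentiable_cst.
exact: differentiable_bigprod.
Qed.

Lemma differentiable_adj n (A : V -> 'M[C]_n) u i j :
  (forall i j, differentiable (fun v => A v i j : C) u) ->
  differentiable (fun v => (\adj (A v)) i j : C) u.
Proof.
move=> hA; rewrite (_ : (fun v => _) =
  fun v => (-1) ^+ (j + i) * \det (row' j (col' i (A v)))); last first.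
  by apply/funext => v; rewrite mxE.
apply: differentiable_mul; first exact: differentiable_cst.
apply: differentiable_det => a b.
rewrite (_ : (fun v => _) = fun v => A v (lift j a) (lift i b)) //.
by apply/funext => v; rewrite !mxE.
Qed.
End DiffBig.

Section AndersenLempert.
Context {R : realType} {k : nat}.
Local Notation C := (Cplx R).
Local Notation V := 'rV[C]_k.

Lemma runge_peval (U K : set V) (f : V -> C) : runge U -> holomorphic U f ->
  compact K -> K `<=` U -> forall e : R, 0 < e ->
  exists p : mpoly.mpoly k C, forall u, K u -> rn (f u - peval p u) <= e.
Proof.
move=> rU hf cK KU e e0.
have [|p hp] := rU f hf K cK KU (cR e); first by rewrite -cR0 cR_lt.
by exists p => u /hp; rewrite rnE cR_lt => /ltW.
Qed.

Lemma runge_apx (U K : set V) (f : V -> C) : runge U -> holomorphic U f ->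
  compact K -> K `<=` U -> apx K f.
Proof.
move=> rU hf cK KU e /(runge_peval rU hf cK KU)[p hp].
by exists (peval p) => //; exact: peval_polyfun.
Qed.

Lemma holomorphic_coord (U : set V) (f : V -> V) j : holomorphic U f ->
  holomorphic U (fun u => f u ord0 j : C).
Proof.
move=> hf u Uu.
exact: (@differentiable_comp _ _ _ _ f (fun v : V => v ord0 j : C) u (hf u Uu)
  (differentiable_coord _ _ _)).
Qed.

Lemma holomorphic_continuous (U : set V) (f : V -> V) : holomorphic U f ->
  forall u, U u -> {for u, continuous f}.
Proof. by move=> hf u Uu; apply: differentiable_continuous; exact: hf. Qed.

Definition bihol_pair (U : set V) (psi G : V -> V) : Prop :=
  [/\ holomorphic U psi, holomorphic setT G, (forall z, U z -> G (psi z) = z),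
      (forall w, U (G w)) & (forall w, psi (G w) = w)].

Lemma mulmx_bound (B : 'M[C]_k) :
  exists2 c : R, 0 <= c & forall z : V, rn (z *m B) <= c * rn z.
Proof.
pose c : R := \big[Num.max/0]_(ij : 'I_k * 'I_k) rn (B ij.1 ij.2 : C).
have c0 : 0 <= c.
  rewrite /c; apply: (big_ind (fun t : R => 0 <= t)) => // [x y x0 _|ij _]; last exact: rn_ge0.
  by rewrite le_max x0.
exists (k%:R * c); first by rewrite mulr_ge0.
move=> z; apply: rn_rowP => [|j]; first by rewrite !mulr_ge0 ?rn_ge0.
rewrite mxE; apply: (@dotg_bound _ _ z (fun i => B i j) c) => i.
exact: (le_bigmax _ (fun ij : 'I_k * 'I_k => rn (B ij.1 ij.2 : C)) (i, j)).
Qed.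

Hypothesis k_ge2 : (2 <= k)%N.
Variables (U : set V) (psi G : V -> V).
Hypotheses (U_open : open U) (U_runge : runge U) (UG : bihol_pair U psi G).

Let psi_hol : holomorphic U psi. Proof. by case: UG. Qed.
Let G_hol : holomorphic setT G. Proof. by case: UG. Qed.
Let G_psi z : U z -> G (psi z) = z. Proof. by case: UG => _ _ + _ _; exact. Qed.
Let G_in w : U (G w). Proof. by case: UG. Qed.
Let psi_G w : psi (G w) = w. Proof. by case: UG. Qed.

Lemma image_ball_compact (r : R) : compact (G @` cball 0 r) /\ G @` cball 0 r `<=` U.
Proof.
split; last by move=> _ [w _ <-].
apply: continuous_compact; last exact: cball_compact.
by apply: continuous_subspaceT => w; exact: (holomorphic_continuous G_hol).
Qed.

(** By compactness, the balls of some fixed radius centred in [L] lie in [U] and [f]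
    has a common bound on them. *)
Lemma taylor_uniform (f : V -> V) (L : set V) : holomorphic U f -> compact L -> L `<=` U ->
  exists d B : R, [/\ 0 < d, 0 <= B & forall u, L u -> forall w,
    rn ('d f u w) <= B * rn w /\
    (rn w <= d -> U (u + w) /\ rn (f (u + w) - f u - 'd f u w) <= B * rn w ^+ 2)].
Proof.
move=> hf cL LU.
pose P n u := forall y, rn (y - u) <= n.+1%:R^-1 -> U y /\ rn (f y) <= n%:R.
have [n hn] : exists n, forall u, L u -> P n u.
  apply: compact_uniform => // u Lu.
  have [d d0 hd] := (open_cballP U).1 U_open u (LU u Lu).
  have cu : forall y, cball u d y -> {for y, continuous f}.
    by move=> y /hd; exact: holomorphic_continuous.
  have [n1 hn1] := compact_rn_bounded (@cball_compact R k u d) cu.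
  have d2 : 0 < d / 2 by rewrite divr_gt0.
  have [n2 hn2] := invS_small d2.
  exists (d / 2), (maxn n1 n2); split => // y m hy; rewrite geq_max => /andP[m1 m2] z hz.
  have zd : cball u d z.
    by have h := le_trans hz (hn2 m m2); rewrite /cball /=; have := rn_tri y z u; lra.
  split; first exact: hd.
  by apply: le_trans (hn1 z zd) _; rewrite ler_nat.
set N : R := n%:R; have N0 : 0 <= N by exact: ler0n.
pose r : R := n.+1%:R^-1 / 2; have r0 : 0 < r by rewrite divr_gt0// invr_gt0.
have r2 : 2 * r = n.+1%:R^-1 by rewrite /r mulrC divfK.
exists (r / 2), (N / r + 2 * N / r ^+ 2).
have B1 : 0 <= N / r by rewrite divr_ge0// ltW.
have B2 : 0 <= 2 * N / r ^+ 2 by rewrite divr_ge0 ?mulr_ge0// exprn_ge0// ltW.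
split; [by rewrite divr_gt0|exact: addr_ge0|move=> u Lu w].
have Pu := hn u Lu; rewrite /P -r2 in Pu.
have hap j : apx (cball u (2 * r)) (fun v => f v ord0 j).
  apply: (runge_apx U_runge (holomorphic_coord j hf)); first exact: cball_compact.
  by move=> v /Pu[].
have fB j y : cball u (2 * r) y -> rn (f y ord0 j : C) <= N.
  by move=> /Pu[_]; apply: le_trans; exact: rn_coord.
have uu : cball u r u by rewrite /cball /= subrr rn0 ltW.
have du : differentiable f u by apply: hf; exact: LU.
have key j : rn ('d f u w ord0 j : C) <= N * (rn w / r) /\
    (rn w <= r / 2 -> rn (f (u + w) ord0 j - f u ord0 j - 'd f u w ord0 j : C)
        <= 2 * N * (rn w / r) ^+ 2).
  rewrite diff_coordE//.
  have [_ _ /(_ N (fB j) u uu w)[h1 h2]] := apx_diff r0 (hap j).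
  by split => // /h2[].
have w0 := rn_ge0 w.
have wr : 0 <= rn w / r by rewrite divr_ge0// ltW.
split.
  rewrite mulrDl; apply: (@le_trans _ _ (N * (rn w / r))); last first.
    by rewrite mulrCA mulrC -[N * _ * _]mulrA lerDl mulr_ge0.
  by apply: rn_rowP => [|j]; [rewrite mulr_ge0|exact: (key j).1].
move=> hw; split.
  by apply: (Pu _ _).1; rewrite [u + w]addrC addrK; lra.
rewrite mulrDl; apply: (@le_trans _ _ (2 * N * (rn w / r) ^+ 2)); last first.
  rewrite exprMn exprVn [rn w ^+ 2 / _]mulrC mulrA lerDr mulr_ge0//.
  exact: exprn_ge0.
apply: rn_rowP => [|j]; first by apply: mulr_ge0; [exact: mulr_ge0|exact: exprn_ge0].
by rewrite !mxE; exact: (key j).2.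
Qed.

Let J (u : V) : 'M[C]_k := \matrix_(i, j) ('d psi u (delta_mx 0 i) ord0 j).

Let JE u (w : V) : 'd psi u w = w *m J u.
Proof.
rewrite {1}[w]row_sum_delta linear_sum; apply/rowP => j.
rewrite summxE mxE; apply: eq_bigr => i _.
by rewrite linearZ /= !mxE.
Qed.

Let J_entry_diff u i j : U u -> differentiable (fun v => J v i j : C) u.
Proof.
move=> Uu; have [d d0 hd] := (open_cballP U).1 U_open u Uu.
have d2 : 0 < d / 2 by rewrite divr_gt0.
have hap : apx (cball u (2 * (d / 2))) (fun v => psi v ord0 j).
  rewrite mulrC divfK//; apply: (runge_apx U_runge (holomorphic_coord j psi_hol)) => //.
  exact: cball_compact.
have [_ /(_ i) h _] := apx_diff d2 hap.
apply: (apx_differentiable d2); apply: apx_ext h => v hv.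
rewrite mxE diff_coordE//; apply/psi_hol/hd.
by rewrite /cball /= in hv *; lra.
Qed.

Let J_unit u : U u -> J u \in unitmx.
Proof.
move=> Uu; rewrite -(G_psi Uu); set w := psi u.
pose A : 'M[C]_k := \matrix_i 'd G w (delta_mx 0 i).
have GW : differentiable G w by exact: G_hol.
have pW : differentiable psi (G w) by exact: psi_hol.
suff /mulmx1_unit[] : A *m J (G w) = 1%:M by [].
apply/row_matrixP => i; rewrite row_mul rowK -JE row1.
have /(congr1 (fun f => f (delta_mx 0 i))) /= <- := diff_comp GW pW.
have -> : psi \o G = id by apply/funext => v /=; exact: psi_G.
by have [_ ->] := is_diff_id w.
Qed.

(** [Z] is the radial field [w |-> w] transported by [G]: its flow is
    [u |-> G (e^t psi u)]. It is holomorphic by the adjugate formula for the inverse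
    of the differential. *)
Lemma conjugated_radial_field : exists2 Z : V -> V,
  (forall j, holomorphic U (fun u => Z u ord0 j : C)) &
  (forall u, U u -> 'd psi u (Z u) = psi u).
Proof.
exists (fun u => psi u *m ((\det (J u))^-1 *: \adj (J u))).
  move=> j u Uu; rewrite (_ : (fun v => _) = fun v => \sum_i psi v ord0 i *
      ((\det (J v))^-1 * (\adj (J v)) i j)); last first.
    by apply/funext => v; rewrite mxE; apply: eq_bigr => i _; rewrite mxE.
  apply: differentiable_bigsum => i; apply: differentiable_mul.
    exact: (holomorphic_coord i psi_hol).
  apply: differentiable_mul.
    apply: differentiableV.
      by apply: differentiable_det => a b; exact: J_entry_diff.
    by have := J_unit Uu; rewrite unitmxE unitfE.
  by apply: differentiable_adj => a b; exact: J_entry_diff.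
move=> u Uu; rewrite JE -mulmxA.
have -> : (\det (J u))^-1 *: \adj (J u) = invmx (J u) by rewrite /invmx J_unit.
by rewrite mulVmx ?mulmx1// J_unit.
Qed.

Lemma entV_affine (p : V) (B : 'M[C]_k) : entV (fun z => p + z *m B).
Proof.
apply: entV_polyfun => j.
rewrite (_ : (fun u : V => _) = (fun u : V => p ord0 j + \sum_i u ord0 i * B i j)).
  apply: polyfun_add; first exact: polyfun_cst.
  apply: polyfun_sum => i; apply: polyfun_mul; first exact: polyfun_coord.
  exact: polyfun_cst.
by apply/funext => u; rewrite !mxE.
Qed.

(** For small [t], the map [z |-> G (t z)] differs from its affine part by an error
    small with respect to [t]. *)
Lemma affine_start (r e : R) : 0 < e -> exists t : R, [/\ 0 < t, t <= 1 &
  exists a b, aut a b /\ forall z, rn z <= r ->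
    U (a z) /\ rn (psi (a z) - cR t *: z) <= e * t].
Proof.
move=> e0; pose p := G 0; have Up : U p by exact: G_in.
pose B := invmx (J p); have Bu : B \in unitmx by rewrite unitmx_inv J_unit.
have [c c0 hc] := mulmx_bound B.
pose M := c * (`|r| + 1) + 1.
have M0 : 0 < M by rewrite /M ltr_wpDl// mulr_ge0// addr_ge0.
have [d1 d10 h1] := differentiable_cballP (psi_hol Up) (divr_gt0 e0 M0).
have [d2 d20 h2] := (open_cballP U).1 U_open p Up.
pose d := Num.min d1 d2; have d0 : 0 < d by rewrite /d lt_min d10.
pose t := Num.min 1 (d / M); have t0 : 0 < t by rewrite /t lt_min ltr01 divr_gt0.
have tM : t * M <= d by rewrite -ler_pdivlMr// /t ge_min lexx orbT.
exists t; split => //; first by rewrite /t ge_min lexx.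
have t0' : cR t != 0 by apply/eqP => /cRI h; rewrite h ltxx in t0.
exists (fun z => p + z *m (cR t *: B)),
  (fun w => (cR t)^-1 *: (- p *m J p) + w *m ((cR t)^-1 *: J p)).
split.
  have BJ : B *m J p = 1%:M by rewrite mulVmx// J_unit.
  have JB : J p *m B = 1%:M by rewrite mulmxV// J_unit.
  split; [exact: entV_affine|exact: entV_affine| |].
  - move=> z /=; rewrite -!scalemxAr mulmxDl scalerDr mulNmx addrA scalerN addNr add0r.
    by rewrite -scalemxAl scalerA mulVf// scale1r -mulmxA BJ mulmx1.
  - move=> w /=; rewrite -!scalemxAr -scalerDr -mulmxDl -scalemxAl scalerA mulfV// scale1r.
    by rewrite -mulmxA JB mulmx1 addrA subrr add0r.
move=> z hz; set w := z *m _.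
have wE : w = cR t *: (z *m B) by rewrite /w -scalemxAr.
have wM : rn w <= t * M.
  rewrite wE rnZ rn_cR gtr0_norm// ler_wpM2l ?(ltW t0)//.
  apply: le_trans (hc z) _; rewrite /M.
  have zr : rn z <= `|r| + 1 by have := ler_norm r; lra.
  by have := ler_wpM2l c0 zr; lra.
have wd : rn w <= d := le_trans wM tM.
split.
  apply: h2; rewrite /cball /= [p + w]addrC addrK.
  by apply: le_trans wd _; rewrite /d ge_min lexx orbT.
have := h1 w (le_trans wd _); rewrite /d ge_min lexx => /(_ isT).
rewrite JE wE -scalemxAl -mulmxA mulVmx ?J_unit// mulmx1 -wE psi_G subr0.
move=> /le_trans; apply; rewrite mulrAC ler_pdivrMr// -mulrA.
by rewrite ler_wpM2l// ltW.
Qed.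

(** The automorphism is close to a step along a polynomial field near [Z]; as [Z]
    is transported from the radial field, [psi] turns the step into a homothety of
    ratio [1 + h]. *)
Lemma radial_step (rho e : R) : 0 < e -> exists2 d : R, 0 < d &
  forall h : R, 0 <= h -> h <= d -> exists s t, aut s t /\
    forall u, U u -> rn (psi u) <= rho ->
      U (s u) /\ rn (psi (s u) - (1 + cR h) *: psi u) <= e * h.
Proof.
move=> e0; have [cL LU] := image_ball_compact rho; set L := _ @` _ in cL LU.
have [d [B [d0 B0 hT]]] := taylor_uniform psi_hol cL LU.
have [Z Zhol hZ] := conjugated_radial_field.
have B1 : 0 < 4 * (B + 1) by rewrite mulr_gt0// ltr_wpDl.
(* The linear part of the Taylor expansion contributes [2 * B * eta * h] and the
   quadratic part [B * (h * m) ^+ 2]; each is made smaller than [e / 2 * h]. *)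
pose eta := e / (4 * (B + 1)); have eta0 : 0 < eta by rewrite divr_gt0.
have /choice[p hp] : forall j, exists p : mpoly.mpoly k C, forall u, L u ->
    rn (Z u ord0 j - peval p u : C) <= eta.
  by move=> j; exact: (runge_peval U_runge (Zhol j) cL LU eta0).
pose Q (u : V) : V := \row_j peval (p j) u.
have QZ u : L u -> rn (Q u - Z u) <= eta.
  move=> Lu; apply: rn_rowP => [|j]; first exact: ltW.
  by rewrite !mxE rn_sub; exact: hp.
have [Qpol Qflow] : flowable Q := flowable_peval p k_ge2.
have [n hn] : exists n : nat, forall u, L u -> rn (id u) <= n%:R.
  by apply: compact_rn_bounded cL _ => u _ A.
have [MQ MQ0 hMQ] := polyfunV_bounded n%:R Qpol.
have [d1 d10 hs] := Qflow n%:R eta eta0.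
pose m := MQ + eta; have m0 : 0 < m by rewrite /m ltr_wpDl.
pose d2 := e / (2 * ((B + 1) * m ^+ 2)).
have Bm : 0 < 2 * ((B + 1) * m ^+ 2) by rewrite !mulr_gt0// ?exprn_gt0// ltr_wpDl.
have d20 : 0 < d2 by rewrite divr_gt0.
exists (Num.min d1 (Num.min (d / m) d2)); first by rewrite !lt_min d10 d20 divr_gt0.
move=> h h0; rewrite !le_min => /and3P[hh1 hh2 hh3].
have rh : rn (cR h) = h by rewrite rn_cR ger0_norm.
have [|s [t [st hst]]] := hs (cR h); first by rewrite rh.
exists s, t; split=> // u Uu hu.
have Lu : L u by exists (psi u); [rewrite cball0E|exact: G_psi].
have ub := hn u Lu; have {hst}hst := hst u ub; rewrite rh in hst.
set w := s u - u; have suE : s u = u + w by rewrite /w [RHS]addrC subrK.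
have wm : rn w <= h * m.
  rewrite -[w](subrK (cR h *: Q u)); apply: le_trans (rnD _ _) _.
  rewrite rnZ rh; have := hMQ u ub; rewrite /m; nra.
have [_ /(_ _)[|Uw hw]] := hT u Lu w.
  by apply: le_trans wm _; rewrite ler_pdivlMr in hh2.
rewrite suE; split => //.
have [hd _] := hT u Lu (w - cR h *: Z u).
have -> : psi (u + w) - (1 + cR h) *: psi u = (psi (u + w) - psi u - 'd psi u w) +
    'd psi u (w - cR h *: Z u).
  rewrite (_ : 'd psi u (w - cR h *: Z u) = 'd psi u w - cR h *: psi u).
    by rewrite scalerDl scale1r opprD !addrA subrK.
  by rewrite -(hZ u Uu) linearB linearZ.
apply: le_trans (rnD _ _) _.
have h1 : rn (w - cR h *: Z u) <= 2 * (h * eta).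
  have -> : w - cR h *: Z u = (w - cR h *: Q u) + cR h *: (Q u - Z u).
    by rewrite scalerBr addrA subrK.
  apply: le_trans (rnD _ _) _; rewrite rnZ rh.
  apply: le_trans (lerD hst (ler_wpM2l h0 (QZ u Lu))) _.
  by rewrite mulrC -mulr2n mulr_natl.
have h2 : B * rn (w - cR h *: Z u) <= e / 2 * h.
  apply: (@le_trans _ _ ((B + 1) * (2 * (h * eta)))).
    by apply: ler_pM => //; rewrite ?rn_ge0// lerDl.
  rewrite le_eqVlt; apply/orP; left; apply/eqP; rewrite /eta; field.
  by rewrite gt_eqF// ltr_wpDl.
have h3 : B * rn w ^+ 2 <= e / 2 * h.
  apply: (@le_trans _ _ ((B + 1) * (h * m) ^+ 2)).
    apply: ler_pM => //; first by rewrite exprn_ge0// rn_ge0.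
      by rewrite lerDl.
    by rewrite lerXn2r// ?nnegrE ?rn_ge0// mulr_ge0// ltW.
  rewrite ler_pdivlMr// in hh3.
  have -> : (B + 1) * (h * m) ^+ 2 = h * (2 * ((B + 1) * m ^+ 2)) / 2 * h by field.
  by rewrite ler_wpM2r// ler_wpM2r// invr_ge0.
apply: le_trans (lerD (le_trans hw h3) (le_trans hd h2)) _.
by rewrite -mulrDl -splitr.
Qed.

(** The error [e] is relative to the scale [t]: in this normalization the errors of
    successive steps add up. *)
Let reached (r t e : R) := exists a b, aut a b /\ forall z, rn z <= r ->
    U (a z) /\ rn (psi (a z) - cR t *: z) <= e * t.

(** The scale grows from a small [t0] to 1 by equal short steps; the affine start
    costs a relative error [e / 3], and the steps at most as much in total. *)
Lemma approximate_inverse (r e : R) : 0 <= r -> 0 < e -> exists a b, aut a b /\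
  forall z, rn z <= r -> U (a z) /\ rn (psi (a z) - z) <= e.
Proof.
move=> r0; wlog e1 : e / e <= 1 => [H e0|e0].
  have m1 : Num.min e 1 <= 1 by rewrite ge_min lexx orbT.
  have m0 : 0 < Num.min e 1 by rewrite lt_min e0 ltr01.
  have [a [b [ab h]]] := H _ m1 m0.
  exists a, b; split => // z /h[h1 h2]; split => //.
  by apply: le_trans h2 _; rewrite ge_min lexx.
have e3 : 0 < e / 3 by rewrite divr_gt0.
have [t0 [t00 t01 start]] := affine_start r e3.
(* A step from [t] to [t'] adds [eta * (t' - t) / (t * t')] to the relative
   error, and both scales are at least [t0]. *)
pose eta := e / 3 * t0 ^+ 2.
have eta0 : 0 < eta by rewrite mulr_gt0// exprn_gt0.
have [d d0 hd] := radial_step (r + 1) eta0.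
have step t t' c : t0 <= t -> t <= t' -> t' <= 1 -> t' - t <= d * t0 -> 0 <= c -> c <= 1 ->
    reached r t c -> reached r t' (c + e / 3 * (t' - t)).
  move=> ht tt' t'1 htd c0 c1 [a [b [ab hab]]].
  have tp : 0 < t := lt_le_trans t00 ht.
  pose h := (t' - t) / t.
  have h0 : 0 <= h by rewrite divr_ge0 ?(ltW tp)// subr_ge0.
  have hhd : h <= d.
    by rewrite ler_pdivrMr//; apply: le_trans htd _; rewrite ler_wpM2l// ltW.
  have [s [s' [ss hs]]] := hd h h0 hhd.
  exists (s \o a), (b \o s'); split; first exact: aut_comp.
  move=> z hz; have [Ua ha] := hab z hz.
  have z0 := rn_ge0 z.
  have pa : rn (psi (a z)) <= r + 1.
    have := rn_tri (cR t *: z) (psi (a z)) 0; rewrite !subr0 rnZ rn_cR gtr0_norm//.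
    have t1 : t <= 1 := le_trans tt' t'1.
    nra.
  have [Us hps] := hs (a z) Ua pa; split => //=.
  have ht' : t' = (1 + h) * t by rewrite /h; field; rewrite gt_eqF.
  have -> : psi (s (a z)) - cR t' *: z = (psi (s (a z)) - (1 + cR h) *: psi (a z)) +
     (1 + cR h) *: (psi (a z) - cR t *: z).
    by rewrite scalerBr scalerA addrA subrK ht' cRM cRD cR1.
  apply: le_trans (rnD _ _) _; rewrite rnZ.
  have -> : rn (1 + cR h : C) = 1 + h.
    by rewrite -cR1 -cRD rn_cR ger0_norm// addr_ge0.
  have h1 : eta * h <= e / 3 * (t' - t) * t'.
    have -> : eta * h = e / 3 * (t' - t) * (t0 * (t0 / t)).
      by rewrite /eta /h; field; rewrite gt_eqF.
    apply: ler_wpM2l; first by rewrite mulr_ge0 ?subr_ge0// ltW.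
    apply: (@le_trans _ _ (t0 * 1)).
      by rewrite ler_wpM2l ?(ltW t00)// ler_pdivrMr// mul1r.
    by rewrite mulr1; apply: le_trans tt'.
  have h2 : (1 + h) * rn (psi (a z) - cR t *: z) <= (1 + h) * (c * t).
    by rewrite ler_wpM2l// addr_ge0.
  have h3 : (1 + h) * (c * t) = c * t' by rewrite ht'; ring.
  rewrite [leRHS]mulrDl addrC; apply: lerD; last exact: le_trans h1.
  by rewrite -h3.
have [n hn] := invS_small (mulr_gt0 d0 t00).
pose N : R := n.+1%:R; have N0 : 0 < N by rewrite ltr0n.
have {}hn : N^-1 <= d * t0 := hn n (leqnn n).
pose tt (i : nat) : R := t0 + i%:R * ((1 - t0) / N).
have ttS i : tt i.+1 = tt i + (1 - t0) / N by rewrite /tt -addn1 natrD mulrDl mul1r addrA.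
have q0 : 0 <= (1 - t0) / N by rewrite divr_ge0 ?subr_ge0// ltW.
have qN : (1 - t0) / N <= N^-1.
  by rewrite -[leRHS]mul1r ler_wpM2r ?invr_ge0 ?(ltW N0)//; lra.
have ttN : tt n.+1 = 1 by rewrite /tt mulrC divfK ?gt_eqF// addrC subrK.
have tt1 i : (i <= n.+1)%N -> tt i <= 1.
  by move=> hi; rewrite -ttN /tt lerD2l ler_wpM2r// ler_nat.
have tt0 i : t0 <= tt i by rewrite /tt lerDl mulr_ge0.
have all_steps i : (i <= n.+1)%N -> reached r (tt i) (e / 3 + e / 3 * (tt i - t0)).
  elim: i => [_|i ih hi].
    by rewrite /tt mul0r addr0 subrr mulr0 addr0; exact: start.
  have -> : e / 3 + e / 3 * (tt i.+1 - t0) =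
    (e / 3 + e / 3 * (tt i - t0)) + e / 3 * (tt i.+1 - tt i) by ring.
  have ti0 := tt0 i; have ti1 := tt1 i (ltnW hi).
  apply: step => //; last exact: ih (ltnW hi).
  - by rewrite ttS lerDl.
  - exact: tt1.
  - by rewrite ttS addrC addKr; exact: le_trans hn.
  - by apply: addr_ge0; [exact: ltW|apply: mulr_ge0; [exact: ltW|rewrite subr_ge0]].
  - nra.
have [a [b [ab h]]] := all_steps n.+1 (leqnn _).
exists a, b; split => // z /h[h1]; rewrite ttN cR1 scale1r mulr1 => h2; split => //.
by apply: le_trans h2 _; nra.
Qed.

(** The last estimate follows from the first one: [psi \o a] is close to the
    identity, hence has a right inverse [S] close to the identity, and
    [b (G z) = S z]. *)
Lemma andersen_lempert (r e : R) : 0 <= r -> 0 < e -> exists a b, aut a b /\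
  forall z, rn z <= r -> [/\ U (a z), rn (psi (a z) - z) <= e & rn (b (G z) - z) <= e].
Proof.
move=> r0 e0; pose e' := Num.min e (1 / 16).
have e'0 : 0 < e' by rewrite /e' lt_min e0 divr_gt0.
have e'e : e' <= e by rewrite /e' ge_min lexx.
have e'1 : e' <= 1 / 16 by rewrite /e' ge_min lexx orbT.
(* [near_id_inverse] loses two units of radius. *)
have r2 : 0 <= r + 2 by lra.
have [a [b [ab h]]] := approximate_inverse r2 e'0.
have [ha hb aK bK] := ab.
have hq : apxV (cball 0 (r + 2)) (psi \o a).
  have cK : compact (a @` cball 0 (r + 2)).
    apply: continuous_compact; last exact: cball_compact.
    by apply: continuous_subspaceT => w; exact: entV_continuous.
  have KU : a @` cball 0 (r + 2) `<=` U.
    by move=> _ [z + <-]; rewrite cball0E => /h[].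
  have [M M0 hM] := entV_bounded (r + 2) ha.
  apply: (apxV_comp (W := a @` cball 0 (r + 2)) (M := M)) => //.
    by move=> j; apply: (runge_apx U_runge (holomorphic_coord j psi_hol)).
  move=> u hu; split; first by exists u.
  by apply: hM; rewrite cball0E in hu.
have [S _ hS] := near_id_inverse e'1 hq (fun z hz => (h z hz).2).
exists a, b; split => // z hz.
have zr2 : rn z <= r + 2 by lra.
have [h1 h2] := h z zr2; split => //; first exact: le_trans e'e.
have [|s1 s2] := hS z; first by rewrite addrK.
rewrite -{1}s2 /= G_psi ?aK; first exact: le_trans e'e.
by apply: (h _ _).1; have := rn_tri z (S z) 0; rewrite !subr0; lra.
Qed.
End AndersenLempert.

(** * Increasing unions *)

Section PushOut.
Context {R : realType} {k : nat}.
Local Notation C := (Cplx R).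
Local Notation V := 'rV[C]_k.

Lemma bihol_pair_aut (U : set V) (psi G s t : V -> V) : bihol_pair U psi G -> aut s t ->
  bihol_pair U (s \o psi) (G \o t).
Proof.
move=> [h1 h2 h3 h4 h5] [hs ht st ts]; split.
- by move=> u Uu; apply: differentiable_comp; [exact: h1|exact: entV_differentiable].
- by move=> u Uu; apply: differentiable_comp; [exact: entV_differentiable|exact: h2].
- by move=> z Uz /=; rewrite st h3.
- by move=> w; exact: h4.
- by move=> w /=; rewrite h5 ts.
Qed.

(** If an automorphism [b] imitates [G], then [s \o b \o psi] maps [U] onto the whole
    space and is close to [s] on [K]; the automorphism [s'] imitates this map. *)
Lemma adjust_automorphism (U K : set V) (psi G s t : V -> V) (r e : R) : (2 <= k)%N ->
  open U -> runge U -> bihol_pair U psi G -> compact K -> K `<=` U ->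
  aut s t -> 0 < e -> exists s' t' (rho : R), [/\ aut s' t', r <= rho,
    forall u, K u -> rn (s' u - s u) <= e /\ rn (s' u) <= rho - 2 &
    forall z, rn z <= rho -> U (t' z)].
Proof.
move=> k2 oU rU UG cK KU st e0; have [psih Gh Gpsi GU psiG] := UG.
have [hs ht _ _] := st.
have [n hn] : exists n : nat, forall u, K u -> rn (psi u) <= n%:R.
  apply: compact_rn_bounded cK _ => u Ku.
  exact: (holomorphic_continuous psih (KU u Ku)).
have e2 : 0 < e / 2 by rewrite divr_gt0.
have sG u : cball 0 n%:R u -> {for u, continuous (s \o G)}.
  move=> _; apply: differentiable_continuous; apply: differentiable_comp.
    exact: Gh.
  exact: entV_differentiable.
have [d d0 hd] := compact_unif_continuous (@cball_compact R k 0 n%:R) sG e2.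
have [b [b' [bb hb]]] := andersen_lempert k2 oU rU UG (ler0n R n) d0.
have bs u : K u -> rn (s (b (psi u)) - s u) <= e / 2.
  move=> Ku; have [Ub hpb _] := hb _ (hn u Ku).
  have := hd (psi u) (psi (b (psi u))) _ hpb.
  rewrite cball0E /= (Gpsi _ Ub) (Gpsi _ (KU _ Ku)).
  by move=> /(_ (hn u Ku)).
pose th := (s \o b) \o psi.
have UG' : bihol_pair U th (G \o (b' \o t)) by apply: bihol_pair_aut UG _; exact: aut_comp.
have [n2 hn2] : exists n : nat, forall u, K u -> rn (th u) <= n%:R.
  have [th_hol _ _ _ _] := UG'; apply: compact_rn_bounded cK _ => u Ku.
  exact: (holomorphic_continuous th_hol (KU u Ku)).
pose rho := Num.max r (n2%:R + e + 2).
have rho1 : r <= rho by rewrite /rho le_max lexx.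
have rho2 : n2%:R + e + 2 <= rho by rewrite /rho le_max lexx orbT.
have n20 : 0 <= n2%:R :> R by exact: ler0n.
have rho0 : 0 <= rho by lra.
have [a [a' [aa ha]]] := andersen_lempert k2 oU rU UG' rho0 e2.
exists a', a, rho; split => //.
- exact: aut_sym.
- move=> u Ku; have hu := hn2 u Ku.
  have [|_ _] := ha (th u); first lra.
  have [_ _ thK _ _] := UG'; rewrite (thK _ (KU _ Ku)) => h1.
  have h2 := bs u Ku; have h3 := rn_tri (th u) (a' u) (s u).
  have h4 := rn_tri (th u) (a' u) 0; rewrite !subr0 in h4.
  split; first by rewrite [leRHS]splitr; exact: le_trans h3 (lerD h1 h2).
  apply: le_trans (le_trans h4 (lerD h1 hu)) _; lra.
- by move=> z /ha[].
Qed.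

Section Sequence.
Variable Omega : nat -> set V.
Hypothesis Omega_incr : forall j, Omega j `<=` Omega j.+1.
Hypothesis Omega_open : forall j, open (Omega j).
Hypothesis Omega_runge : forall j, runge (Omega j).
Hypothesis k_ge2 : (2 <= k)%N.
Variables (psi G : nat -> V -> V).
Hypothesis Omega_bihol : forall j, bihol_pair (Omega j) (psi j) (G j).

Let Omega_mono i j : (i <= j)%N -> Omega i `<=` Omega j.
Proof.
elim: j => [|j ih]; first by rewrite leqn0 => /eqP ->.
rewrite leq_eqVlt => /predU1P[->//|]; rewrite ltnS => /ih h u /h.
exact: Omega_incr.
Qed.

(** The compact set treated at step [n] contains [A n], the set where
    [rn (s n u) <= rho n], and, for all [i <= n + 1], the part of [Omega i] which
    [psi i] sends to the ball of radius [n + 1]; so the sets [A n] increase and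
    exhaust the union. *)
Lemma automorphism_sequence : exists (s t : nat -> V -> V) (rho : nat -> R),
  [/\ forall n, aut (s n) (t n), forall n, n%:R <= rho n,
      forall n z, rn z <= rho n -> Omega n (t n z),
      forall n u, rn (s n u) <= rho n ->
        rn (s n.+1 u - s n u) <= 1 / 64 * (1 / 2) ^+ n /\ rn (s n.+1 u) <= rho n.+1 - 2 &
      forall i u, Omega i u -> exists n, rn (s n u) <= rho n - 2].
Proof.
pose St := ((V -> V) * (V -> V) * R)%type.
pose P n (x : St) := aut x.1.1 x.1.2 /\ forall z, rn z <= x.2 -> Omega n (x.1.2 z).
pose K n (x : St) : set V := (\big[setU/set0]_(i < n.+2) (G i @` cball 0 n.+1%:R)) `|`
   (x.1.2 @` cball 0 x.2).
(* With the constant 1/64, all later corrections add up to at most 1/16, the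
   threshold of [near_id_inverse]. *)
pose Nx n (x y : St) := [/\ P n.+1 y, n.+1%:R <= y.2 &
  forall u, K n x u -> rn (y.1.1 u - x.1.1 u) <= 1 / 64 * (1 / 2) ^+ n /\
     rn (y.1.1 u) <= y.2 - 2].
have [x0 [Px0 x00]] : exists x, P 0%N x /\ 0 <= x.2.
  have [||||s [t [rho [st r0 _ hr]]]] := @adjust_automorphism (Omega 0%N) set0 (psi 0%N) (G 0%N)
     id id 0 1 k_ge2 (@Omega_open 0%N) (@Omega_runge 0%N) (@Omega_bihol 0%N).
  - exact: compact0.
  - by [].
  - exact: aut_id.
  - by [].
  by exists (s, t, rho).
have /choice[F hF] : forall nx : nat * St, exists y, P nx.1 nx.2 -> Nx nx.1 nx.2 y.
  move=> [n x] /=; have [Px|nP] := pselect (P n x); last by exists x.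
  have [st hx] := Px; have e0 : 0 < 1 / 64 * (1 / 2) ^+ n :> R.
    by rewrite mulr_gt0 ?half_pow_gt0// divr_gt0.
  have cK : compact (K n x).
    apply: compactU.
      by apply: bigsetU_compact => i _; have [] := image_ball_compact (@Omega_bihol i) n.+1%:R.
    apply: continuous_compact; last exact: cball_compact.
    by apply: continuous_subspaceT => w; apply: entV_continuous; case: st.
  have KO : K n x `<=` Omega n.+1.
    move=> u [|[z + <-]]; last by rewrite cball0E => /hx; exact: Omega_incr.
    rewrite -(bigcup_mkord n.+2 (fun i => G i @` cball 0 n.+1%:R)) => -[i /= hi hu].
    apply: (Omega_mono (i := i)); first by rewrite -ltnS.
    by have [_] := image_ball_compact (@Omega_bihol i) n.+1%:R; exact.
  have [s [t [rho [st' r0 h1 h2]]]] := adjust_automorphism n.+1%:R k_ge2 (@Omega_open n.+1)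
     (@Omega_runge n.+1) (@Omega_bihol n.+1) cK KO st e0.
  by exists (s, t, rho).
pose X := fix X n : St := if n is n'.+1 then F (n', X n') else x0.
have PX n : P n (X n).
  by elim: n => [//|n ih] /=; have [] := hF (n, X n) ih.
have NX n : Nx n (X n) (X n.+1) := hF (n, X n) (PX n).
exists (fun n => (X n).1.1), (fun n => (X n).1.2), (fun n => (X n).2); split.
- by move=> n; have [] := PX n.
- by case=> [//|n]; have [] := NX n.
- by move=> n; have [_] := PX n.
- move=> n u hu; have [_ _] := NX n; apply; right; exists ((X n).1.1 u).
    by rewrite cball0E.
  by have [[_ _ ->]] := PX n.
- move=> i u Oiu; pose N := (Num.truncn (rn (psi i u))).+1.
  have hN : rn (psi i u) < N%:R by rewrite truncnS_gt.
  exists (maxn i N).+1; have [_ _ h] := NX (maxn i N).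
  apply: (h u _).2; left.
  rewrite -(bigcup_mkord _ (fun l => G l @` cball 0 (maxn i N).+1%:R)).
  exists i => /=.
    by rewrite !ltnS (leq_trans (leq_maxl i N)).
  exists (psi i u); last by have [_ _ ->] := @Omega_bihol i.
  rewrite cball0E; apply: le_trans (ltW hN) _; rewrite ler_nat.
  by rewrite (leq_trans (leq_maxr i N)).
Qed.

(** Near a given point, the inverse of the limit [th] is [t n \o S] for [n] large,
    where [S] inverts [th \o t n], a map close to the identity. *)
Lemma pushout_biholomorphic : biholomorphic (\bigcup_j Omega j) [set: V].
Proof.
have [s [t [rho [st rho_ge tO sS Oex]]]] := automorphism_sequence.
have sent n : entV (s n) by case: (st n).
have tent n : entV (t n) by case: (st n).
have sK n : cancel (s n) (t n) by case: (st n).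
have tK n : cancel (t n) (s n) by case: (st n).
pose A n u := rn (s n u) <= rho n.
pose A' n u := rn (s n u) <= rho n - 2.
have A'A n u : A' n u -> A n u by rewrite /A' /A; lra.
have AS n u : A n u -> A' n.+1 u by move=> /sS[].
have Amono n m u : (n <= m)%N -> A n u -> A m u.
  elim: m => [|m ih]; first by rewrite leqn0 => /eqP ->.
  by rewrite leq_eqVlt => /predU1P[->//|]; rewrite ltnS => /ih h /h /AS /A'A.
have A'mono n m u : (n <= m)%N -> A' n u -> A' m u.
  rewrite leq_eqVlt => /predU1P[->//|]; case: m => // m; rewrite ltnS => nm /A'A.
  by move=> /(Amono _ _ _ nm)/AS.
have AO n u : A n u -> Omega n u by move=> /tO; rewrite sK.
have /choice[th hth] : forall u, exists l, forall n, A n u -> forall N, (n <= N)%N ->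
    rn (l - s N u) <= 1 / 16 * (1 / 2) ^+ N.
  move=> u; have [ex|nex] := pselect (exists n, A n u); last first.
    by exists 0 => n An; exfalso; apply: nex; exists n.
  have ex' : exists n, `[< A n u >] by have [n An] := ex; exists n; apply/asboolP.
  case: (ex_minnP ex') => n0 /asboolP An0 nmin.
  have sb m : rn (s (n0 + m.+1)%N u - s (n0 + m)%N u) <= 1 / 64 * (1 / 2) ^+ n0 * (1 / 2) ^+ m.
    have [h _] := sS (n0 + m)%N u (Amono _ _ _ (leq_addr m n0) An0).
    by rewrite addnS -mulrA -exprD.
  have [l hl] := geometric_cvg sb.
  exists l => n /asboolP/nmin n0n N nN.
  have := hl (N - n0)%N; rewrite subnKC ?(leq_trans n0n nN)//.
  move=> /le_trans; apply; rewrite mulrA -[X in X <= _]mulrA -exprD subnKC ?(leq_trans n0n nN)//.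
  by have := half_pow_gt0 (R := R) N; lra.
have th_lim n (e : R) : 0 < e ->
    exists N, (n <= N)%N /\ forall u, A n u -> rn (th u - s N u) <= e.
  move=> e0; have [m hm] := half_pow_small (1 / 16) e0.
  exists (n + m)%N; split; first exact: leq_addr.
  move=> u An; apply: le_trans (hth u n An _ (leq_addr m n)) _; apply: le_trans hm.
  rewrite ler_wpM2l ?divr_ge0// exprD -[leRHS]mul1r.
  apply: ler_pM; rewrite ?exprn_ge0 ?divr_ge0// exprn_ile1 ?divr_ge0//; lra.
have th_near n u : A n u -> rn (th u - s n u) <= 1 / 16.
  move=> An; apply: le_trans (hth u n An n (leqnn n)) _.
  rewrite -[leRHS]mulr1 ler_wpM2l ?divr_ge0// exprn_ile1 ?divr_ge0//; lra.
have apx_th n W : W `<=` A n -> (exists M : R, forall u, W u -> rn u <= M) -> apxV W th.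
  move=> WA [M hM]; apply: apxV_lim => e /(th_lim n)[N [_ hN]].
  exists (s N); last by move=> u /WA; exact: hN.
  by apply: apxVS (sent N M) => u /hM; rewrite cball0E.
pose q n := th \o t n.
have Aq n z : rn z <= rho n -> A n (t n z) by rewrite /A tK.
have q_near n z : rn z <= rho n -> rn (q n z - z) <= 1 / 16.
  by move=> /Aq /th_near; rewrite tK.
have q_apx n : apxV (cball 0 (rho n)) (q n).
  have [M M0 hM] := entV_bounded (rho n) (tent n).
  apply: (apxV_comp (W := A n `&` [set u | rn u <= M]) (M := M)).
  - apply: (apx_th n) => [u []//|]; exists M => u [] //.
  - exact: tent.
  - by move=> z; rewrite cball0E => hz; split; [split; [exact: Aq|exact: hM]|exact: hM].
have th_inj u v n : A' n u -> A' n v -> th u = th v -> u = v.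
  move=> Au Av uv; rewrite -(sK n u) -(sK n v); congr (t n _).
  apply: (near_id_inj (lexx _) (@q_apx n) (@q_near n)); rewrite /q /= ?sK//.
    by move: Au; rewrite /A'; lra.
  by move: Av; rewrite /A'; lra.
have common u v : (\bigcup_j Omega j) u -> (\bigcup_j Omega j) v ->
    exists n, A' n u /\ A' n v.
  move=> [i _ /Oex[n hn]] [j _ /Oex[m hm]]; exists (maxn n m).
  by split; [apply: A'mono (leq_maxl n m) _|apply: A'mono (leq_maxr n m) _].
have local_inverse n : exists2 S : V -> V, apxV (cball 0 (rho n - 3)) (t n \o S) &
    forall w, rn w <= rho n - 3 -> A' n (t n (S w)) /\ th (t n (S w)) = w.
  have [S S1 S2] := near_id_inverse (lexx _) (@q_apx n) (@q_near n).
  have Sr w : rn w <= rho n - 3 -> rn (S w) <= rho n - 2.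
    move=> hw; have [|h _] := S2 w; first lra.
    by have := rn_tri w (S w) 0; rewrite !subr0; lra.
  exists S.
    apply: (entV_apx (M := rho n - 2)) => //.
    - by move=> u; rewrite cball0E; exact: Sr.
    - by apply: apxVS S1 => u; rewrite !cball0E; lra.
  move=> w hw; split; first by rewrite /A' tK; exact: Sr.
  have hw2 : rn w <= rho n - 2 by lra.
  by have [_] := S2 w hw2.
have big (c : R) : exists n, c <= rho n.
  exists (Num.truncn c).+1; apply: le_trans (rho_ge _); apply: ltW.
  exact: truncnS_gt.
have /choice[ka hka] : forall w, exists u, (\bigcup_j Omega j) u /\ th u = w.
  move=> w; have [n hn] := big (rn w + 3).
  have [S _ /(_ w)[|h1 h2]] := local_inverse n; first lra.
  by exists (t n (S w)); split => //; exists n => //; exact/AO/A'A.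
exists th, ka; split.
- move=> u [i _ /Oex[n hn]].
  have cu : {for u, continuous (s n)} by exact: entV_continuous.
  have /continuous_cballP /(_ 1 ltr01)[d d0 hd] := cu.
  apply: (apxV_differentiable d0); apply: (apx_th n).
    move=> v /hd h; rewrite /A; have := rn_tri (s n u) (s n v) 0; rewrite !subr0; lra.
  by exists (rn u + d) => v /cball_rn.
- move=> w _; have [n hn] := big (rn w + 4).
  have [S S1 S2] := local_inverse n.
  have wb v : cball w 1 v -> rn v <= rho n - 3 by move=> /cball_rn; lra.
  apply: (@apxV_differentiable _ _ _ _ 1) => // j.
  apply: (@apx_ext _ _ _ (fun v => (t n \o S) v ord0 j)); last first.
    by apply: apxS (S1 j) => v /wb; rewrite cball0E.
  move=> v /wb hv; congr (fun_of_matrix _ _ _).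
  have [h1 h2] := S2 v hv; have [h3 h4] := hka v.
  have h5 : (\bigcup_j Omega j) (t n (S v)) by exists n => //; exact/AO/A'A.
  have [m [m1 m2]] := common _ _ h5 h3.
  by apply: th_inj m1 m2 _; rewrite h4.
- move=> z Oz; split => //; have [h1 h2] := hka (th z).
  by have [n [n1 n2]] := common _ _ h1 Oz; exact: th_inj n1 n2 h2.
- by move=> w _; exact: hka.
Qed.
End Sequence.
End PushOut.

Theorem proposition3 (R : realType) (k : nat) (k_ge2 : (2 <= k)%N)
    (Omega : nat -> set 'rV[Cplx R]_k)
    (Omega_incr : forall j, Omega j `<=` Omega j.+1)
    (Omega_FB : forall j, fatou_bieberbach (Omega j))
    (Omega_runge : forall j, runge (Omega j)) :
  biholomorphic (\bigcup_j Omega j) [set: 'rV[Cplx R]_k].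
Proof.
have Omega_open j : open (Omega j) by have [] := Omega_FB j.
have /choice[psiG psiGP] : forall j, exists fg, bihol_pair (Omega j) fg.1 fg.2.
  move=> j; have [_ _ _ [f [g [hf hg fK gK]]]] := Omega_FB j.
  exists (f, g); split => //=.
  - by move=> z /fK[].
  - by move=> w; have [] := gK w I.
  - by move=> w; have [] := gK w I.
exact: (pushout_biholomorphic Omega_incr Omega_open Omega_runge k_ge2 psiGP).
Qed.
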